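(* Assume that the origin of the $yz$-plane is contained in a subregion of $\tilde{\mathcal S}_h$. Then there exists $k\in\{1,2,3,4\}$ such that $\tilde X_k$ and $\tilde X_{k+1}$ are two consecutive vectors (indices mod 4) whose endpoints are corners of this subregion and of $\tilde{\mathcal S}$. Furthermore, if $$\det(\tilde X_k\ \tilde X_{k+1})>0,$$ then the stability of the sliding vector field is of node, focus or center type. On the other hand, if $$\det(\tilde X_k\ \tilde X_{k+1})<0,$$ then the stability of the sliding vector field is of saddle type.
   Context: Setting. Let $\mathcal U\subset\mathbb R^3$ with coordinates $(x,y,z)$, $\mathcal I$ an interval, $\Lambda=\{(x,0,0):x\in\mathcal I\}$, $\mathcal Q_1=\{y\ge0,z\ge0\}$, $\mathcal Q_2=\{y\le0,z\ge0\}$, $\mathcal Q_3=\{y\le0,z\le0\}$, $\mathcal Q_4=\{y\ge0,z\le0\}$. The piecewise smooth system is $(\dot x,\dot y,\dot z)^T=X_i$ on $\mathcal Q_i$ with smooth $X_i=(\alpha_i,\beta_i,\gamma_i)^T$; standing assumption: $\alpha_i,\beta_i,\gamma_i$ depend only on $x$. Fix $x\in\mathcal I$, $\tilde X_i=(\beta_i,\gamma_i)^T\in\mathbb R^2$ evaluated at $x$. For $(\psi,\phi)\in(-1,1)^2$ let $$\tilde F_x(\psi,\phi)=\tfrac12\Big(\tfrac{\tilde X_1}{2}(1+\phi)+\tfrac{\tilde X_4}{2}(1-\phi)\Big)(1+\psi)+\tfrac12\Big(\tfrac{\tilde X_2}{2}(1+\phi)+\tfrac{\tilde X_3}{2}(1-\phi)\Big)(1-\psi),$$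 $\tilde{\mathcal S}=\tilde F_x((-1,1)^2)$, a region of the $yz$-plane. Regions. With indices mod 4, let $\delta_i=\det(\tilde X_{i+1}-\tilde X_i\ \ \tilde X_{i+2}-\tilde X_{i+1})$. $\tilde{\mathcal S}$ is one of: a convex projection (all $\delta_i$ of the same sign), a crossed projection (two positive, two negative), a concave projection (three of one sign, one of the opposite sign). $\tilde{\mathcal S}_n\subseteq\tilde{\mathcal S}$ is the set of points with exactly two preimages under $\tilde F_x$ in $(-1,1)^2$. If $\tilde{\mathcal S}_n\ne\emptyset$, the parabolic line $\mathcal L_p$ is the curved line that is both a boundary of $\tilde{\mathcal S}_n$ and of $\tilde{\mathcal S}$. The homeomorphic region $\tilde{\mathcal S}_h$ is the set of points of $\tilde{\mathcal S}\setminus\mathcal L_p$ with exactly one preimage. A subregion of $\tilde{\mathcal S}_h$ is a connected component ($\tilde{\mathcal S}_h$ has two disjoint ones in the crossed case). Sliding and stability. Sliding vector fields at $(x,0,0)$ correspond to zeros $(\psi_*,\phi_* )\in(-1,1)^2$ of $\tilde F_x$; with $\sigma_\psi=(1+\psi_* )/2$, $\sigma_\phi=(1+\phi_* )/2$, the $x$-component is $\sigma_\psi\sigma_\phi\alpha_1+(1-\sigma_\psi)\sigma_\phi\alpha_2+(1-\sigma_\psi)(1-\sigma_\phi)\alpha_3+\sigma_\psi(1-\sigma_\phi)\alpha_4$. Given regularization functions $\psi,\phi:\mathbb R\to[-1,1]$ (smooth, positive derivative where the value lies in $(-1,1)$, limits $\pm1$ at $\pm\infty$, and $r\mapsto\psi(r^{-1}),\phi(r^{-1})$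 extending smoothly to $r=0$ from either side), let $\mathbf J=\mathbf D\tilde F_x(\psi_*,\phi_* )\,\mathrm{diag}(\psi'(\psi^{-1}(\psi_* )),\phi'(\phi^{-1}(\phi_* )))$, the Jacobian of $(\hat y',\hat z')^T=\tilde F_x(\psi(\hat y),\phi(\hat z))$ at the corresponding equilibrium. The stability is of saddle type if $\det\mathbf J<0$ (equivalently $\det\mathbf D\tilde F_x(\psi_*,\phi_* )<0$) and of node, focus or center type if $\det\mathbf J>0$. *)

(* Defs.v *)
From HB Require Import structures.
From mathcomp Require Export all_boot all_order all_algebra.
From mathcomp Require Export all_classical all_reals all_analysis.
Export Order.TTheory GRing.Theory Num.Theory.
Export numFieldNormedType.Exports.

Set Implicit Arguments.
Unset Strict Implicit.
Unset Printing Implicit Defensive.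

#[export] Set Implicit Arguments.
#[export] Unset Strict Implicit.
#[export] Unset Printing Implicit Defensive.

Global Open Scope classical_set_scope.
Global Open Scope ring_scope.

(* Quadrants, and the vectors attached to them, are indexed by 'Z_4: the
   indices 1, 2, 3, 4 are the numerals of this ring (so 4 = 0) and k + 1 is the
   next index mod 4.  Vectors of the yz-plane are column vectors 'cV[R]_2, and
   a point (psi, phi) of the parameter plane is a pair p : R * R. *)

Section Definitions.
Variable R : realType.

Implicit Types (X : 'Z_4 -> 'cV[R]_2) (A T : set 'cV[R]_2) (p : R * R).

(* f restricted to A is C^oo: it has a C^oo extension to an open set
   containing A. *)
Definition smooth_on (A : set R) (f : R -> R) : Prop :=
  exists (V : set R) (g : R -> R),
    [/\ open V, A `<=` V, {in A, f =1 g} &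
        forall (n : nat) (t : R), V t -> derivable (derive1n n g) t 1].

Definition det2 (u v : 'cV[R]_2) : R := \det (row_mx u v : 'M[R]_2).

Definition yz_field (beta gamma : 'Z_4 -> R -> R) (x : R) (i : 'Z_4) : 'cV[R]_2 :=
  \col_(j < 2) (if j == 0 then beta i x else gamma i x).

Definition square : set (R * R) := [set` `](-1), 1[] `*` [set` `](-1), 1[].

Definition Ftilde X p : 'cV[R]_2 :=
  ((1 + p.1) / 2) *: (((1 + p.2) / 2) *: X 1 + ((1 - p.2) / 2) *: X 4)
  + ((1 - p.1) / 2) *: (((1 + p.2) / 2) *: X 2 + ((1 - p.2) / 2) *: X 3).

Definition Stilde X : set 'cV[R]_2 := Ftilde X @` square.

Definition turn X (i : 'Z_4) : R :=
  det2 (X (i + 1) - X i) (X (i + 2) - X (i + 1)).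

Definition npos X : nat := #|[pred i : 'Z_4 | 0 < turn X i]|.
Definition nneg X : nat := #|[pred i : 'Z_4 | turn X i < 0]|.

Definition convex_projection X : Prop := npos X = 4%N \/ nneg X = 4%N.
Definition crossed_projection X : Prop := npos X = 2%N /\ nneg X = 2%N.
Definition concave_projection X : Prop :=
  (npos X = 3%N /\ nneg X = 1%N) \/ (npos X = 1%N /\ nneg X = 3%N).

Definition preimages X (q : 'cV[R]_2) : set (R * R) :=
  square `&` (Ftilde X @^-1` [set q]).

Definition boundary A : set 'cV[R]_2 := closure A `\` interior A.

Definition Sn X : set 'cV[R]_2 :=
  [set q | Stilde X q /\ (preimages X q #= `I_2)%card].

(* Empty when Sn is.  In the crossed case this intersection also contains the
   crossing point of the two sides, which does not belong to Stilde. *)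
Definition parabolic_line X : set 'cV[R]_2 :=
  boundary (Sn X) `&` boundary (Stilde X).

Definition Sh X : set 'cV[R]_2 :=
  [set q | (Stilde X `\` parabolic_line X) q /\ (preimages X q #= `I_1)%card].

Definition subregion X T : Prop :=
  exists2 q, Sh X q & T = connected_component (Sh X) q.

(* A C^1 arc [0, e) -> R^2, given by a function that is C^1 around 0. *)
Definition C1_at0 (c : R -> 'cV[R]_2) : Prop :=
  (\forall t \near 0, derivable c t 1) /\ {for 0, continuous (derive1 c)}.

(* q is a corner of A if, near q, the boundary of A is the union of two C^1
   arcs issued from q whose tangents at q are not collinear. *)
Definition corner A (q : 'cV[R]_2) : Prop :=
  exists (c1 c2 : R -> 'cV[R]_2) (e : R),
    [/\ 0 < e,
        (C1_at0 c1 /\ c1 0 = q) /\ (C1_at0 c2 /\ c2 0 = q),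
        det2 (derive1 c1 0) (derive1 c2 0) != 0 &
        \forall r \near (q : 'cV[R]_2), boundary A r <->
          exists2 t : R, 0 <= t < e & (r = c1 t \/ r = c2 t)].

Definition corner_pair X T (k : 'Z_4) : Prop :=
  [/\ corner T (X k), corner T (X (k + 1)),
      corner (Stilde X) (X k) & corner (Stilde X) (X (k + 1))].

(* v is the x-component of the sliding vector field given by the zero p of
   Ftilde; its y- and z-components vanish. *)
Definition sliding_vector_field (alpha beta gamma : 'Z_4 -> R -> R) (x : R)
    p (v : R) : Prop :=
  let spsi := (1 + p.1) / 2 in
  let sphi := (1 + p.2) / 2 in
  [/\ square p, Ftilde (yz_field beta gamma x) p = 0 &
      v = spsi * sphi * alpha 1 x + (1 - spsi) * sphi * alpha 2 x
          + (1 - spsi) * (1 - sphi) * alpha 3 x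
          + spsi * (1 - sphi) * alpha 4 x].

Definition regularization (f : R -> R) : Prop :=
  [/\ (forall t, -1 <= f t <= 1) /\ smooth_on setT f,
      forall t, -1 < f t < 1 -> 0 < derive1 f t,
      f t @[t --> +oo] --> (1 : R), f t @[t --> -oo] --> (-1 : R) &
      (exists2 g : R -> R, (forall r : R, 0 < r -> g r = f r^-1) &
         smooth_on [set` `[0, +oo[] g) /\
      (exists2 g : R -> R, (forall r : R, r < 0 -> g r = f r^-1) &
         smooth_on [set` `]-oo, 0]] g)].

(* The inverse of f where f takes values in (-1, 1); f is injective there. *)
Definition reg_inv (f : R -> R) : R -> R :=
  'pinv_(fun=> 0) [set t | -1 < f t < 1] f.

Definition DFtilde X p : 'M[R]_2 :=
  row_mx (derive1 (fun s => Ftilde X (s, p.2)) p.1)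
         (derive1 (fun s => Ftilde X (p.1, s)) p.2).

Definition Jac X (psi phi : R -> R) p : 'M[R]_2 :=
  DFtilde X p *m
  diag_mx (\row_(j < 2) (if j == 0 then derive1 psi (reg_inv psi p.1)
                         else derive1 phi (reg_inv phi p.2))).

Definition saddle_type (J : 'M[R]_2) : Prop := \det J < 0.
Definition node_focus_center_type (J : 'M[R]_2) : Prop := 0 < \det J.

End Definitions.

(* Main.v *)
Require Import Defs.
From mathcomp Require Import ring lra.

(* Seen from a corner X_k, the region is a bilinear patch
   X_k + a U + b V + ab E, 0 < a, b < 1.  In the frame (U, V) its coordinates are
   a (1 + e b) and b (1 + f a), its Jacobian is proportional to J = 1 + e b + f a,
   and the only other parameter (a', b') with the same image satisfies
   f a' = - (1 + e b) and e b' = - (1 + f a).  Hence the homeomorphic region is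
   the set of points with a unique preimage and J <> 0, and near a corner at which
   J has the sign of one of the adjacent corners, the region is an open sector.
   Three or four corners share the sign of J (convex and concave cases) or two
   adjacent ones do (crossed case).  From the preimage of the origin, a segment of
   the parameter square to a suitable corner and then along a side stays in the
   homeomorphic region, so that the subregion of the origin has two consecutive
   corners; its other corners are excluded because the reentrant corner is interior
   to the region and the two triangles of the crossed case are separated by a line.
   Finally, at a zero (a, b) of the patch det(X_k X_{k+1}) is b times the Jacobian
   at (a, 0), which has the sign of the Jacobian at (a, b). *)

(** * Algebra of the normalized bilinear map on the unit square *)

Section BilinearCoordinates.
Variable R : realType.
Implicit Types e f a b m n t c eps M : R.

Definition bcoord e a b : R := a * (1 + e * b).
Definition bjac e f a b : R := 1 + e * b + f * a.
Definition buniq e f a b : Prop := forall a' b', 0 < a' < 1 -> 0 < b' < 1 ->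
  bcoord e a' b' = bcoord e a b -> bcoord f b' a' = bcoord f b a ->
  a' = a /\ b' = b.

(** Source of the small radii below: with M = |e| + |f|, parameters bounded by c keep 1 + e b, 1 + f
    a within 1/8 of 1 and the Jacobian at least 3/4. *)
Lemma exists_small M eps : 0 <= M -> 0 < eps ->
  exists2 c, 0 < c < eps & M * c <= 8^-1.
Proof.
move=> M0 eps0; have M1 : 0 < 8 * (M + 1) by lra.
exists (Num.min (eps / 2) (8 * (M + 1))^-1).
  by rewrite lt_min invr_gt0 M1 gt_min; apply/andP; split; lra.
apply: (@le_trans _ _ (M * (8 * (M + 1))^-1)).
  by rewrite ler_wpM2l// ge_min lexx orbT.
by rewrite ler_pdivrMr//; lra.
Qed.

(* The points (a, b) and (a', b') correspond to the same unordered pair of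
   tangents to the parabola enveloped by the coordinate lines. *)
Lemma mirrorP e f a b a' b' :
  bcoord e a' b' = bcoord e a b -> bcoord f b' a' = bcoord f b a ->
  bjac e f a b != 0 -> ~ (a' = a /\ b' = b) ->
  [/\ e != 0, f != 0, f * a' = - (1 + e * b) & e * b' = - (1 + f * a)].
Proof.
rewrite /bcoord /bjac => E1 E2 J0 ne.
have e0 : e != 0.
  apply/eqP => e0; apply: ne; have aa : a' = a by move: E1; rewrite e0; lra.
  split=> //; move: E2 J0; rewrite e0 aa mul0r addr0 => E2 J0.
  by apply: (mulIf J0).
have f0 : f != 0.
  apply/eqP => f0; apply: ne; have bb : b' = b by move: E2; rewrite f0; lra.
  split=> //; move: E1 J0; rewrite f0 bb mul0r addr0 => E1 J0.
  by apply: (mulIf J0).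
split=> //.
  (* Eliminating b' leaves a quadratic in a' with the known root a; the other factor is the mirror
     relation. The same is done for b' below. *)
  have /eqP : (a' - a) * (f * a' + 1 + e * b) = 0.
    have : (a' * (1 + e * b')) * (1 + f * a') = (a * (1 + e * b)) * (1 + f * a').
      by rewrite E1.
    have -> : (a' * (1 + e * b')) * (1 + f * a') =
      a' * (1 + f * a') + e * a' * (b' * (1 + f * a')) by ring.
    rewrite E2; move=> H.
    transitivity ((a' * (1 + f * a') + e * a' * (b * (1 + f * a))) -
      (a * (1 + e * b) * (1 + f * a'))); first by ring.
    by rewrite H subrr.
  rewrite mulf_eq0 => /orP[/eqP aa|/eqP]; last by lra.
  have {}aa : a' = a by lra.
  exfalso; apply: ne; split=> //; move: E1 E2; rewrite aa => E1 E2.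
  have [a0|a0] := eqVneq a 0; first by move: E2; rewrite a0; lra.
  by apply: (mulfI e0); apply: (mulfI a0); lra.
have /eqP : (b' - b) * (e * b' + 1 + f * a) = 0.
  have : (b' * (1 + f * a')) * (1 + e * b') = (b * (1 + f * a)) * (1 + e * b').
    by rewrite E2.
  have -> : (b' * (1 + f * a')) * (1 + e * b') =
    b' * (1 + e * b') + f * b' * (a' * (1 + e * b')) by ring.
  rewrite E1; move=> H.
  transitivity ((b' * (1 + e * b') + f * b' * (a * (1 + e * b))) -
    (b * (1 + f * a) * (1 + e * b'))); first by ring.
  by rewrite H subrr.
rewrite mulf_eq0 => /orP[/eqP bb|/eqP]; last by lra.
have {}bb : b' = b by lra.
exfalso; apply: ne; split=> //; move: E1 E2; rewrite bb => E1 E2.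
have [b0|b0] := eqVneq b 0; first by move: E1; rewrite b0; lra.
by apply: (mulfI f0); apply: (mulfI b0); lra.
Qed.

Lemma mirror_bcoord e f a b a' b' : e != 0 -> f != 0 ->
  f * a' = - (1 + e * b) -> e * b' = - (1 + f * a) ->
  bcoord e a' b' = bcoord e a b /\ bcoord f b' a' = bcoord f b a.
Proof.
rewrite /bcoord => e0 f0 E1 E2; split.
  by rewrite E2; apply: (mulfI f0); rewrite mulrA E1; ring.
by rewrite E1; apply: (mulfI e0); rewrite mulrA E2; ring.
Qed.

(** A mirror point inside the square would be (a, b) itself by uniqueness, and then f a = - (1 + e
    b) makes the Jacobian vanish. *)
Lemma no_mirror e f a b a' b' : bjac e f a b != 0 -> buniq e f a b ->
  e != 0 -> f != 0 -> f * a' = - (1 + e * b) -> e * b' = - (1 + f * a) ->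
  0 < a' < 1 -> 0 < b' < 1 -> False.
Proof.
move=> J0 u e0 f0 E1 E2 ha hb.
have [F1 F2] := mirror_bcoord e0 f0 E1 E2.
have [aa _] := u _ _ ha hb F1 F2; move/eqP: J0; apply.
by rewrite /bjac; move: E1; rewrite aa; lra.
Qed.

Lemma div_unit (x y : R) : (0 < x < y -> 0 < x / y < 1)
  /\ (y < x < 0 -> 0 < x / y < 1).
Proof.
split=> /andP[h1 h2].
  by rewrite divr_gt0 ?ltr_pdivrMr ?mul1r//; apply: lt_trans h2.
rewrite ltr_ndivrMr ?mul1r ?h1 ?andbT ?(lt_trans h1)// nmulr_lgt0//.
by rewrite invr_lt0 (lt_trans h1).
Qed.

Lemma no_mirror_div e f a b : bjac e f a b != 0 -> buniq e f a b ->
  e != 0 -> f != 0 ->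
  0 < - (1 + e * b) / f < 1 -> 0 < - (1 + f * a) / e < 1 -> False.
Proof.
move=> J0 u e0 f0; apply: (no_mirror J0 u e0 f0); by rewrite mulrC divfK.
Qed.

Lemma gtN1_mul (e b : R) : -1 < e -> 0 < b < 1 -> -1 < e * b.
Proof.
move=> h /andP[b0 b1].
have : 0 < (1 + e) * b by apply: mulr_gt0 => //; lra.
by rewrite mulrDl mul1r; lra.
Qed.

(** If the Jacobian were negative, e and f would both be negative and the mirror of (a, b) would
    fall inside the square. *)
Lemma bjac_pos_of_uniq e f a b : -1 < e -> -1 < f -> 0 < a < 1 -> 0 < b < 1 ->
  buniq e f a b -> bjac e f a b != 0 -> 0 < bjac e f a b.
Proof.
move=> he hf ha hb u J0; rewrite ltNge; apply/negP => J1.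
have {}J1 : bjac e f a b < 0 by rewrite lt_neqAle J0.
have eb := gtN1_mul he hb; have fa := gtN1_mul hf ha.
move: (J1); rewrite /bjac => J2.
have f0 : f < 0.
  rewrite ltNge; apply/negP => f0.
  have : 0 <= f * a by rewrite mulr_ge0//; lra.
  by lra.
have e0 : e < 0.
  rewrite ltNge; apply/negP => e0.
  have : 0 <= e * b by rewrite mulr_ge0//; lra.
  by lra.
have fa1 : f < f * a by rewrite -subr_gt0 -{2}(mulr1 f) -mulrBr nmulr_rgt0//; lra.
have eb1 : e < e * b by rewrite -subr_gt0 -{2}(mulr1 e) -mulrBr nmulr_rgt0//; lra.
apply: (no_mirror_div J0 u); rewrite ?lt_eqF//.
  by apply: (proj2 (div_unit _ _)); lra.
by apply: (proj2 (div_unit _ _)); lra.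
Qed.

Lemma scale_lt_of_neg e b t : e < 0 -> 0 < b -> 0 < t <= 1 -> e * b <= e * (t * b).
Proof.
move=> e0 b0 /andP[t0 t1].
have : 0 <= - e * ((1 - t) * b).
  apply: mulr_ge0; first by lra.
  by apply: mulr_ge0; lra.
have -> : - e * ((1 - t) * b) = e * (t * b) - e * b by ring.
by lra.
Qed.

Lemma lt_mul_unit e b : 0 < b < 1 ->
  (0 < e -> 0 < e * b < e) /\ (e < 0 -> e < e * b < 0).
Proof.
move=> /andP[b0 b1]; split=> e0; apply/andP; split.
- exact: mulr_gt0.
- by rewrite gtr_pMr.
- by rewrite ltr_nMr.
- by rewrite nmulr_rlt0.
Qed.

(** Contraction towards the corner (0, 0). The Jacobian is affine and equals 1 at the corner, so it
    stays positive; uniqueness passes from (a, b) to (t a, t b) by comparing mirrors. *)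
Lemma segment_uniq e f a b t : -1 < f -> -1 < e \/ (e < -1 /\ 1 + e + f < 0) ->
  0 < a < 1 -> 0 < b < 1 -> 0 < bjac e f a b -> buniq e f a b -> 0 < t <= 1 ->
  buniq e f (t * a) (t * b) /\ 0 < bjac e f (t * a) (t * b).
Proof.
move=> hf he ha hb J0 u ht; have J1 : 0 < bjac e f (t * a) (t * b).
  have -> : bjac e f (t * a) (t * b) = (1 - t) + t * bjac e f a b.
    by rewrite /bjac; ring.
  have : 0 < t * bjac e f a b by apply: mulr_gt0 => //; lra.
  by lra.
split=> // a' b' ha' hb' E1 E2; apply: contrapT => ne.
have [e0 f0 F1 F2] := mirrorP E1 E2 (lt0r_neq0 J1) ne.
move: (J0); rewrite /bjac => J2.
(* The mirror (a', b') of (t a, t b) lies in the square; monotonicity in t puts the mirror of (a, b)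
   there too, against its uniqueness. *)
apply: (no_mirror_div (lt0r_neq0 J0) u e0 f0).
  have [f1|f1] : f < 0 \/ 0 < f by lra.
    have [_ /(_ f1) fa'] := lt_mul_unit f ha'.
    have [_ /(_ f1) fa] := lt_mul_unit f ha.
    apply: (proj2 (div_unit _ _)).
    have [e1|e1] : e < 0 \/ 0 < e by lra.
      by have := @scale_lt_of_neg e b t e1; lra.
    have : 0 < e * (t * b) by apply: mulr_gt0 => //; apply: mulr_gt0; lra.
    have [/(_ e1) eb' _] := lt_mul_unit e hb'.
    have := gtN1_mul hf ha.
    have : f * a <= f * (t * a) by apply: scale_lt_of_neg => //; lra.
    by lra.
  have [/(_ f1) fa' _] := lt_mul_unit f ha'.
  have [/(_ f1) fa _] := lt_mul_unit f ha.
  have [e1|e1] : e < 0 \/ 0 < e by lra.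
    apply: (proj1 (div_unit _ _)).
    by have := @scale_lt_of_neg e b t e1; lra.
  have : 0 < e * (t * b) by apply: mulr_gt0 => //; apply: mulr_gt0; lra.
  by lra.
have fa := gtN1_mul hf ha.
have e1 : e < 0.
  case: he => [he|]; last by lra.
  rewrite ltNge; apply/negP => e1.
  have : 0 <= e * b' by apply: mulr_ge0; lra.
  have : -1 < f * (t * a) by apply: gtN1_mul => //; apply/andP; split; nra.
  by lra.
apply: (proj2 (div_unit _ _)); apply/andP; split; last by lra.
have [_ /(_ e1) eb'] := lt_mul_unit e hb'.
have [f1|f1] : f < 0 \/ 0 < f by lra.
  have [_ /(_ f1) fa1] := lt_mul_unit f ha.
  have : f * a <= f * (t * a) by apply: scale_lt_of_neg => //; lra.
  by lra.
have [/(_ f1) fa1 _] := lt_mul_unit f ha.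
case: he; last by lra.
move=> he; have := gtN1_mul he hb.
have [/(_ f1) fa' _] := lt_mul_unit f ha'.
have : -1 < e * (t * b) by apply: gtN1_mul => //; apply/andP; split; nra.
by lra.
Qed.

(** On the side b = 0 the Jacobian 1 + f a is bounded below by min 1 (1 + f), so it stays positive
    on nearby lines b = eta. A mirror (a', b') of (a, eta) would make it vanish at (a', eta), on the
    same line. *)
Lemma edge_uniq e f : -1 < f -> exists2 eta0, 0 < eta0 & forall eta a,
  0 < eta < eta0 -> 0 < a < 1 -> buniq e f a eta /\ 0 < bjac e f a eta.
Proof.
move=> hf; have k0 : 0 < 8 * Num.min 1 (1 + f).
  by rewrite mulr_gt0// lt_min; lra.
(* The factor 8 cancels the 1/8 of [exists_small], leaving |e| c <= min 1 (1 + f). *)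
have [c c0 hc] := @exists_small `|e / (8 * Num.min 1 (1 + f))| 1 (normr_ge0 _) ltr01.
have J0 eta a : 0 < eta < c -> 0 < a < 1 -> 0 < bjac e f a eta.
  move=> heta ha; rewrite /bjac.
  have : `|e| * c <= Num.min 1 (1 + f).
    move: hc; rewrite normrM normfV (gtr0_norm k0) mulrAC ler_pdivrMr//; lra.
  rewrite le_min => /andP[h1 h2].
  have : `|e * eta| < `|e| * c \/ e = 0.
    have [->|e0] := eqVneq e 0; [by right|left].
    by rewrite normrM ltr_pM2l ?normr_gt0// gtr0_norm; lra.
  have fa : Num.min 1 (1 + f) <= 1 + f * a.
    have [f0|f0] : 0 <= f \/ f < 0 by lra.
      by rewrite ge_min; apply/orP; left; have : 0 <= f * a; [apply: mulr_ge0; lra|lra].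
    by rewrite ge_min; apply/orP; right; have [_ /(_ f0)] := lt_mul_unit f ha; lra.
  have m0 : 0 < Num.min 1 (1 + f) by rewrite lt_min; lra.
  case=> [h|->]; last by rewrite mul0r; lra.
  have := ler_norm (- (e * eta)); rewrite normrN => h3.
  have : `|e| * c <= Num.min 1 (1 + f) by rewrite le_min h1.
  by lra.
exists c; first by lra.
move=> eta a heta ha; split; last exact: J0.
move=> a' b' ha' hb' E1 E2; apply: contrapT => ne.
have [_ _ F1 _] := mirrorP E1 E2 (lt0r_neq0 (J0 _ _ heta ha)) ne.
by have := J0 _ _ heta ha'; rewrite /bjac F1; lra.
Qed.

(** The point found is the mirror of the corner (1, 1); its Jacobian is - (1 + e + f). This is the
    reentrant corner of the concave case. *)
Lemma bad_corner e f : -1 < e -> -1 < f -> 1 + e + f < 0 ->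
  exists a b, [/\ 0 < a < 1, 0 < b < 1, bjac e f a b != 0,
    bcoord e a b = 1 + e & bcoord f b a = 1 + f].
Proof.
move=> he hf hef; have e0 : e != 0 by rewrite lt_eqF//; lra.
have f0 : f != 0 by rewrite lt_eqF//; lra.
exists (- (1 + e * 1) / f), (- (1 + f * 1) / e).
have E1 : f * (- (1 + e * 1) / f) = - (1 + e * 1) by rewrite mulrC divfK.
have E2 : e * (- (1 + f * 1) / e) = - (1 + f * 1) by rewrite mulrC divfK.
have [F1 F2] := mirror_bcoord e0 f0 E1 E2.
split.
- by apply: (proj2 (div_unit _ _)); lra.
- by apply: (proj2 (div_unit _ _)); lra.
- by rewrite /bjac E1 E2 gt_eqF//; lra.
- by rewrite F1 /bcoord; lra.
- by rewrite F2 /bcoord; lra.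
Qed.

(** In the image coordinates (m, n) the expression is 1 + f - f m + e n, so it vanishes on a line,
    which passes through the crossing point of the sides a = 0 and a = 1. For f <> 0 the mirror
    ordinate always lies in (0, 1), so uniqueness forces the mirror abscissa out of (0, 1), and this
    fixes the sign. *)
Lemma crossed_sep e f a b : e < -1 -> -1 < f -> 1 + e + f < 0 ->
  0 < a < 1 -> 0 < b < 1 -> buniq e f a b ->
  (0 < bjac e f a b -> 0 < 1 + e * b + (1 - a) * f) /\
  (bjac e f a b < 0 -> 1 + e * b + (1 - a) * f < 0).
Proof.
move=> he hf hef ha hb u; have e0 : e != 0 by rewrite lt_eqF//; lra.
have [->|f0] := eqVneq f 0; first by rewrite /bjac; split; lra.
have mirb : 0 < - (1 + f * a) / e < 1.
  apply: (proj2 (div_unit _ _)); have := gtN1_mul hf ha => ?.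
  have [f1|f1] : f < 0 \/ 0 < f by lra.
    by have [_ /(_ f1)] := lt_mul_unit f ha; lra.
  by have [/(_ f1) ? _] := lt_mul_unit f ha; lra.
have key : bjac e f a b != 0 -> ~ (0 < - (1 + e * b) / f < 1).
  by move=> J0 h; apply: (no_mirror_div J0 u).
have {key}key : bjac e f a b != 0 ->
  ~ (0 < - (1 + e * b) < f) /\ ~ (f < - (1 + e * b) < 0).
  move=> J0; split=> h; apply: (key J0).
    exact: (proj1 (div_unit _ _)).
  exact: (proj2 (div_unit _ _)).
have [f1|f1] : f < 0 \/ 0 < f by lra.
  have [_ /(_ f1) fa] := lt_mul_unit f ha.
  split=> J0.
    have [_] := key (lt0r_neq0 J0); move: J0; rewrite /bjac => J0 /negP.
    by rewrite negb_and -!leNgt => /orP[]; lra.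
  have [_] := key (ltr0_neq0 J0); move: J0; rewrite /bjac => J0 /negP.
  by rewrite negb_and -!leNgt => /orP[]; nra.
have [/(_ f1) fa _] := lt_mul_unit f ha.
split=> J0.
  have [+ _] := key (lt0r_neq0 J0); move: J0; rewrite /bjac => J0 /negP.
  by rewrite negb_and -!leNgt => /orP[]; lra.
have [+ _] := key (ltr0_neq0 J0); move: J0; rewrite /bjac => J0 /negP.
by rewrite negb_and -!leNgt => /orP[]; lra.
Qed.

Lemma norm_mul_le8 e c x : `|e| * c <= 8^-1 -> `|x| <= c -> - 8^-1 <= e * x <= 8^-1.
Proof.
move=> h hx; rewrite -ler_norml normrM; apply: le_trans h.
by rewrite ler_wpM2l.
Qed.

(** Local surjectivity at (0, 0) without the inverse function theorem: eliminating one unknown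
    leaves a quadratic, to which the intermediate value theorem applies. *)
Lemma bcoord_solve e f eps : 0 < eps -> exists2 del, 0 < del & forall m n,
  `|m| < del -> `|n| < del -> exists x y,
  [/\ `|x| < eps, `|y| < eps, bcoord e x y = m & bcoord f y x = n].
Proof.
move=> eps0; have M0 : 0 <= `|e| + `|f| by rewrite addr_ge0.
have [c /andP[c0 ceps] hc] := exists_small M0 eps0.
(* With |m| < c / 4 the linear term of the quadratic dominates m at x = c and x = - c. *)
have c4 : 0 < c / 4 by lra.
have [del /andP[del0 delc] hdel] := exists_small M0 c4.
exists del => // m n hm hn.
have small g k x : 0 <= k -> `|g| <= `|e| + `|f| -> (`|e| + `|f|) * k <= 8^-1 ->
    `|x| <= k -> - 8^-1 <= g * x <= 8^-1.
  move=> k0 g0 h hx; rewrite -ler_norml normrM; apply: le_trans h.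
  by apply: ler_pM.
have ee : `|e| <= `|e| + `|f| by rewrite lerDl.
have ff : `|f| <= `|e| + `|f| by rewrite lerDr.
have hen := small e del n (ltW del0) ee hdel (ltW hn).
have hfm := small f del m (ltW del0) ff hdel (ltW hm).
have hfc := small f c c (ltW c0) ff hc.
rewrite gtr0_norm// lexx in hfc; have {}hfc := hfc isT.
move: (hm) (hn); rewrite !ltr_norml => hm' hn'.
(* Substituting y = n / (1 + f x) into x (1 + e y) = m and clearing the denominator gives h. *)
pose h : {poly R} := f%:P * 'X^2 + (1 + e * n - m * f)%:P * 'X - m%:P.
have hE x : h.[x] = f * x ^+ 2 + (1 + e * n - f * m) * x - m.
  by rewrite /h !hornerE/=; ring.
have cc : - c <= c by lra.
have sgn : h.[- c] <= 0 <= h.[c].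
  rewrite !hE; apply/andP; split.
    have : 0 <= c * (1 + e * n - f * m - f * c - 4^-1).
      by apply: mulr_ge0; lra.
    rewrite sqrrN expr2; lra.
  have : 0 <= c * (1 + e * n - f * m + f * c - 4^-1).
    by apply: mulr_ge0; lra.
  rewrite expr2; lra.
have [x xc] := poly_ivt cc sgn.
rewrite /root hE => /eqP hx.
have xc' : `|x| <= c by rewrite ler_norml.
have hfx := small f c x (ltW c0) ff hc xc'.
have fx0 : 1 + f * x != 0 by rewrite gt_eqF//; lra.
have yE : bcoord f (n / (1 + f * x)) x = n by rewrite /bcoord divfK.
exists x, (n / (1 + f * x)); split=> //.
- exact: le_lt_trans ceps.
- rewrite normrM normfV ltr_pdivrMr ?normr_gt0// (@gtr0_norm _ (1 + f * x)); last by lra.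
  have : eps * (1 / 2) <= eps * (1 + f * x) by rewrite ler_pM2l//; lra.
  by lra.
rewrite /bcoord; apply: (mulIf fx0).
transitivity (x * (1 + f * x + e * (n / (1 + f * x) * (1 + f * x)))); first by ring.
by rewrite divfK//; lra.
Qed.

(** Only parameters near (0, 0) land near the corner: 1 + e b >= min 1 (1 + e) makes a small, then 1
    + f a is close to 1 and b is small. *)
Lemma bcoord_small e f eps : -1 < e -> 0 < eps -> exists2 del, 0 < del &
  forall a b, 0 < a < 1 -> 0 < b < 1 -> bcoord e a b < del ->
  bcoord f b a < del -> a < eps /\ b < eps.
Proof.
move=> he eps0; have [c /andP[c0 ceps] hc] := exists_small (normr_ge0 f) eps0.
have k0 : 0 < Num.min 1 (1 + e) by rewrite lt_min; lra.
exists (Num.min (Num.min 1 (1 + e) * c) (c / 2)).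
  by rewrite lt_min mulr_gt0//=; lra.
move=> a b ha hb; rewrite !lt_min /bcoord => /andP[h1 _] /andP[_ h2].
have h3 : Num.min 1 (1 + e) <= 1 + e * b.
  rewrite ge_min; have [e0|e0] : 0 <= e \/ e < 0 by lra.
    by apply/orP; left; have : 0 <= e * b; [apply: mulr_ge0; lra|lra].
  apply/orP; right; have : 0 < - e * (1 - b) by apply: mulr_gt0; lra.
  by lra.
have ac : a < c.
  rewrite -(ltr_pM2l k0); apply: le_lt_trans h1.
  by rewrite mulrC ler_pM2l//; lra.
split; first by lra.
have : - 8^-1 <= f * a by have := @norm_mul_le8 f c a hc; rewrite gtr0_norm; lra.
move=> fa; have : 0 < b * (f * a + 1 / 2) by apply: mulr_gt0; lra.
by lra.
Qed.

(** Near such a corner the image is exactly the open sector. Existence comes from [bcoord_solve] and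
    localization from [bcoord_small]. A second preimage would also be small, whereas the mirror
    relation f a' = - (1 + e b) keeps f a' close to -1. *)
Lemma corner_coords e f : -1 < e \/ -1 < f -> exists2 del, 0 < del &
  forall m n, `|m| < del -> `|n| < del ->
  (0 < m -> 0 < n -> exists a b,
    [/\ 0 < a < 1, 0 < b < 1, bcoord e a b = m & bcoord f b a = n]) /\
  (forall a b, 0 < a < 1 -> 0 < b < 1 -> bcoord e a b = m -> bcoord f b a = n ->
   [/\ 0 < m, 0 < n, 0 < bjac e f a b & buniq e f a b]).
Proof.
move=> ef; have M0 : 0 <= `|e| + `|f| by rewrite addr_ge0.
have [c /andP[c0 c1] hc] := exists_small M0 (ltr01 : 0 < 1 :> R).
have [del del0 hdel] : exists2 del, 0 < del &
    forall a b, 0 < a < 1 -> 0 < b < 1 -> bcoord e a b < del ->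
    bcoord f b a < del -> a < c /\ b < c.
  case: ef => [he|hf]; first exact: bcoord_small.
  have [del del0 h] := @bcoord_small f e c hf c0.
  by exists del => // a b ha hb h1 h2; have [] := h b a hb ha h2 h1.
have [del' del'0 hdel'] := @bcoord_solve e f c c0.
have hb x : `|x| <= c -> - 8^-1 <= e * x <= 8^-1.
  apply: norm_mul_le8 => //; apply: le_trans hc.
  by rewrite ler_pM2r// lerDl.
have ha x : `|x| <= c -> - 8^-1 <= f * x <= 8^-1.
  apply: norm_mul_le8 => //; apply: le_trans hc.
  by rewrite ler_pM2r// lerDr.
have pos x : 0 < x -> x < c -> `|x| <= c by move=> x0 xc; rewrite gtr0_norm// ltW.
exists (Num.min del del'); first by rewrite lt_min del0.
move=> m n; rewrite !lt_min => /andP[m1 m2] /andP[n1 n2]; split.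
  move=> m0 n0; have [x [y [hx hy E1 E2]]] := hdel' _ _ m2 n2.
  have := hb _ (ltW hy); have := ha _ (ltW hx) => fx ey.
  move: (hx) (hy); rewrite !ltr_norml => hx' hy'.
  have x0 : 0 < x by move: m0; rewrite -E1 /bcoord pmulr_lgt0//; lra.
  have y0 : 0 < y by move: n0; rewrite -E2 /bcoord pmulr_lgt0//; lra.
  by exists x, y; split=> //; lra.
move=> a b a01 b01 E1 E2.
have [ac bc] : a < c /\ b < c.
  apply: hdel => //; first by rewrite E1; apply: le_lt_trans m1; exact: ler_norm.
  by rewrite E2; apply: le_lt_trans n1; exact: ler_norm.
have fa : - 8^-1 <= f * a <= 8^-1 by apply/ha/pos; lra.
have eb : - 8^-1 <= e * b <= 8^-1 by apply/hb/pos; lra.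
have J0 : 0 < bjac e f a b by rewrite /bjac; lra.
split=> //.
- by rewrite -E1 /bcoord mulr_gt0//; lra.
- by rewrite -E2 /bcoord mulr_gt0//; lra.
move=> a' b' a01' b01' F1 F2; apply: contrapT => ne.
have [_ _ G1 _] := mirrorP F1 F2 (lt0r_neq0 J0) ne.
have [ac' bc'] : a' < c /\ b' < c.
  apply: hdel => //; first by rewrite F1 E1; apply: le_lt_trans m1; exact: ler_norm.
  by rewrite F2 E2; apply: le_lt_trans n1; exact: ler_norm.
have : - 8^-1 <= f * a' <= 8^-1 by apply/ha/pos; lra.
by lra.
Qed.

(** The left side is the discriminant of the quadratic f a^2 + (1 + e n - f m) a - m satisfied by a
    over the image point (m, n); hence it is nonnegative on the image. *)
Lemma bcoord_disc e f a b :
  (1 + e * bcoord f b a - f * bcoord e a b) ^+ 2 + 4 * f * bcoord e a b =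
  bjac e f a b ^+ 2.
Proof. by rewrite /bcoord /bjac; ring. Qed.

(** If e = 0 or f = 0, a zero of the Jacobian collapses a whole coordinate segment to one point. *)
Lemma fold_neq0 e f a b : 0 < a < 1 -> 0 < b < 1 -> bjac e f a b = 0 ->
  buniq e f a b -> e != 0 /\ f != 0.
Proof.
rewrite /bjac => ha hb J0 u; split; apply/eqP => e0.
  have [] := u a (b / 2) ha; first by lra.
  - by rewrite /bcoord e0; ring.
  - by rewrite /bcoord; have -> : 1 + f * a = 0 by [move: J0; rewrite e0; lra]; ring.
  by move=> _; lra.
have [] := u (a / 2) b _ hb; first by lra.
- by rewrite /bcoord; have -> : 1 + e * b = 0 by [move: J0; rewrite e0; lra]; ring.
- by rewrite /bcoord e0; ring.
by lra.
Qed.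

(** The image displacement is even in t, so the parameters t and - t give the two preimages that
    merge at the fold. *)
Lemma fold_pair e f a b t : e != 0 -> f != 0 -> bjac e f a b = 0 ->
  [/\ bcoord e (a + t / f) (b + t / e) = bcoord e a b + t ^+ 2 / f,
      bcoord f (b + t / e) (a + t / f) = bcoord f b a + t ^+ 2 / e &
      bjac e f (a + t / f) (b + t / e) = 2 * t].
Proof.
rewrite /bjac /bcoord => e0 f0 J0.
have E : e * (t / e) = t by rewrite mulrC divfK.
have F : f * (t / f) = t by rewrite mulrC divfK.
have E1 : 1 + e * b = - (f * a) by lra.
have F1 : 1 + f * a = - (e * b) by lra.
split.
- have -> : e * (b + t / e) = e * b + t by rewrite mulrDr E.
  by rewrite addrA E1; field.
- have -> : f * (a + t / f) = f * a + t by rewrite mulrDr F.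
  by rewrite addrA F1; field.
- rewrite !mulrDr E F; lra.
Qed.

End BilinearCoordinates.

(* The filter that [nbhs] infers on column vectors is not syntactically the one
   of the topological structure. *)
#[local] Instance col_nbhs_filter (R : realType) (r : 'cV[R]_2) :
  ProperFilter (nbhs r).
Proof. exact: (@nbhs_pfilter 'cV[R]_2 r). Qed.

(** * Affine frames of the plane and corners of sectors *)

Section Frames.
Variable R : realType.
Implicit Types (O U V E r : 'cV[R]_2) (a b del : R) (A : set 'cV[R]_2).

Lemma det_mx22 (M : 'M[R]_2) : \det M = M 0 0 * M 1 1 - M 0 1 * M 1 0.
Proof.
rewrite (expand_det_row _ 0) !big_ord_recl big_ord0 addr0 /cofactor !det_mx11 !mxE.
have -> : lift (0 : 'I_2) 0 = 1 by apply: val_inj.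
have -> : lift (1 : 'I_2) 0 = 0 by apply: val_inj.
by rewrite /= expr0 mul1r expr1 mulN1r mulrN.
Qed.

Lemma det2E U V : det2 U V = U 0 0 * V 1 0 - U 1 0 * V 0 0.
Proof.
have El i : row_mx U V i 0 = U i 0.
  by rewrite -(row_mxEl U V i 0); congr (row_mx U V i _); exact: val_inj.
have Er i : row_mx U V i 1 = V i 0.
  by rewrite -(row_mxEr U V i 0); congr (row_mx U V i _); exact: val_inj.
by rewrite /det2 det_mx22 !El !Er (mulrC (V 0 0)).
Qed.

Lemma col2P U V : U 0 0 = V 0 0 -> U 1 0 = V 1 0 -> U = V.
Proof.
move=> h0 h1; apply/colP => i; have : (i == 0) || (i == 1).
  by case: i => [[|[|]]].
by case/orP => /eqP ->.
Qed.

Lemma is_derive_line O U (t : R) : is_derive t 1 (fun s : R => O + s *: U) U.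
Proof.
have H : h^-1 *: (((fun s : R => O + s *: U) \o shift t) (h *: 1) - (O + t *: U))
    @[h --> (0:R)^'] --> U.
  apply: cvg_near_cst; near=> h; have h0 : h != 0 by near: h; exact: nbhs_dnbhs_neq.
  rewrite /= [h *: 1]mulr1 opprD addrACA subrr add0r -scalerBl addrK scalerA.
  by rewrite mulVf// scale1r.
by apply: DeriveDef; [apply/cvg_ex; exists U|exact: cvg_lim].
Unshelve. all: by end_near. Qed.

Lemma derive1_line O U (t : R) : derive1 (fun s : R => O + s *: U) t = U.
Proof. by rewrite derive1E; apply: derive_val; exact: is_derive_line. Qed.

Lemma C1_at0_line O U : C1_at0 (fun s : R => O + s *: U).
Proof.
split.
  by near=> t; apply: ex_derive; exact: is_derive_line.
rewrite (_ : derive1 _ = fun=> U); first exact: cst_continuous.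
by apply/funext => t; rewrite derive1_line.
Unshelve. all: by end_near. Qed.

(** Cramer's rule for the coordinates in the frame (O; U, V). *)
Definition xcoord O U V r := det2 (r - O) V / det2 U V.
Definition ycoord O U V r := det2 U (r - O) / det2 U V.
Definition bilpt O U V E a b := O + a *: U + b *: V + (a * b) *: E.

Lemma coord_cont (i : 'I_2) : continuous (fun r : 'cV[R]_2 => r i 0).
Proof. exact: coord_continuous. Qed.

Lemma xcoord_continuous O U V : continuous (xcoord O U V).
Proof.
move=> r.
have c (i : 'I_2) (k : R) :
    (fun s : 'cV[R]_2 => (s i 0 - O i 0) * k) @ r --> (r i 0 - O i 0) * k.
  by apply: cvgMr_tmp; exact: (cvgB (@coord_cont i r) (cvg_cst (O i 0))).
have E : xcoord O U V = fun s => ((s 0 0 - O 0 0) * V 1 0 -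
    (s 1 0 - O 1 0) * V 0 0) * (det2 U V)^-1.
  by apply/funext => s; rewrite /xcoord det2E !mxE.
by rewrite E; exact: (cvgMr_tmp (cvgB (c 0 (V 1 0)) (c 1 (V 0 0)))).
Qed.

Lemma ycoordE O U V r : ycoord O U V r = xcoord O V U r.
Proof. by rewrite /ycoord /xcoord !det2E -[LHS]mulrNN -invrN; congr (_ / _); ring. Qed.

Lemma ycoord_continuous O U V : continuous (ycoord O U V).
Proof.
rewrite (_ : ycoord O U V = xcoord O V U); first exact: xcoord_continuous.
by apply/funext => r; rewrite ycoordE.
Qed.

Section FixedFrame.
Variables (O U V : 'cV[R]_2).
Hypothesis d0 : det2 U V != 0.

Lemma frame_decomp r : r = O + xcoord O U V r *: U + ycoord O U V r *: V.
Proof.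
by move: d0; rewrite /xcoord /ycoord !det2E => d1; apply: col2P; rewrite !mxE; field.
Qed.

Lemma xcoord_comb a b : xcoord O U V (O + a *: U + b *: V) = a.
Proof. by move: d0; rewrite /xcoord !det2E !mxE => d1; field. Qed.

Lemma ycoord_comb a b : ycoord O U V (O + a *: U + b *: V) = b.
Proof. by move: d0; rewrite /ycoord !det2E !mxE => d1; field. Qed.

Lemma frame_inj r s : xcoord O U V r = xcoord O U V s ->
  ycoord O U V r = ycoord O U V s -> r = s.
Proof. by move=> h1 h2; rewrite (frame_decomp r) (frame_decomp s) h1 h2. Qed.

Lemma xcoord_bilpt E a b :
  xcoord O U V (bilpt O U V E a b) = bcoord (det2 E V / det2 U V) a b.
Proof. by move: d0; rewrite /xcoord /bcoord /bilpt !det2E !mxE => d1; field. Qed.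

Lemma ycoord_bilpt E a b :
  ycoord O U V (bilpt O U V E a b) = bcoord (det2 U E / det2 U V) b a.
Proof. by move: d0; rewrite /ycoord /bcoord /bilpt !det2E !mxE => d1; field. Qed.

Lemma near_box del r : 0 < del -> `|xcoord O U V r| < del ->
  `|ycoord O U V r| < del ->
  \forall s \near r, `|xcoord O U V s| < del /\ `|ycoord O U V s| < del.
Proof.
move=> del0 h1 h2; near=> s; split; near: s.
- have : `|xcoord O U V s| @[s --> r] --> `|xcoord O U V r|.
    by apply: cvg_norm; exact: xcoord_continuous.
  by move=> /cvgr_lt; apply.
- have : `|ycoord O U V s| @[s --> r] --> `|ycoord O U V r|.
    by apply: cvg_norm; exact: ycoord_continuous.
  by move=> /cvgr_lt; apply.
Unshelve. all: by end_near. Qed.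

Lemma coords_origin : xcoord O U V O = 0 /\ ycoord O U V O = 0.
Proof.
by have := (xcoord_comb 0 0, ycoord_comb 0 0); rewrite !scale0r !addr0 => -[].
Qed.

Lemma near_origin del : 0 < del ->
  \forall s \near O, `|xcoord O U V s| < del /\ `|ycoord O U V s| < del.
Proof.
by move=> del0; have [h1 h2] := coords_origin; apply: near_box => //; rewrite ?h1 ?h2 normr0.
Qed.

(** Moving from r in the direction U + V makes both coordinates positive. *)
Lemma closure_sector A r :
  0 <= xcoord O U V r -> 0 <= ycoord O U V r ->
  (\forall s \near r, 0 < xcoord O U V s -> 0 < ycoord O U V s -> A s) ->
  closure A r.
Proof.
move=> x0 y0 hA B /(filterI hA) rB.
have c : r + t *: (U + V) @[t --> (0:R)^'+] --> r.
  apply: cvg_at_right_filter; rewrite -[X in _ --> X]addr0.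
  apply: cvgD; first exact: cvg_cst.
  rewrite -[X in _ --> X](scale0r (U + V)).
  by apply: cvgZr_tmp; exact: cvg_id.
have /filter_ex [t /= [t0]] :
  \forall t \near (0:R)^'+, 0 < t /\
    ((fun s => (0 < xcoord O U V s -> 0 < ycoord O U V s -> A s)) `&` B)
      (r + t *: (U + V)).
  by near=> t; split; near: t; [exact: nbhs_right_gt|exact: (c _ rB)].
move=> [At Bt]; exists (r + t *: (U + V)); split=> //.
rewrite (_ : r + _ = O + (xcoord O U V r + t) *: U + (ycoord O U V r + t) *: V) in At *.
  by apply: At; rewrite ?xcoord_comb ?ycoord_comb; lra.
rewrite {1}(frame_decomp r) scalerDr !scalerDl -!addrA.
by congr (_ + (_ + _)); rewrite addrCA.
Unshelve. all: by end_near. Qed.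

(** The arcs are the half-lines O + t U and O + t V: a boundary point near O has nonnegative
    coordinates that are not both positive. *)
Lemma corner_sector A del : 0 < del ->
  (forall r, `|xcoord O U V r| < del -> `|ycoord O U V r| < del ->
    A r <-> 0 < xcoord O U V r /\ 0 < ycoord O U V r) ->
  corner A O.
Proof.
move=> del0 hA; exists (fun t => O + t *: U), (fun t => O + t *: V), 1.
split=> //.
- by split; split; rewrite ?scale0r ?addr0//; exact: C1_at0_line.
- by rewrite !derive1_line.
(* The bound 1 keeps the parameter on each half-line below the arc length e = 1. *)
have del1 : 0 < Num.min del 1 by rewrite lt_min del0 ltr01.
near=> r.
have [] : `|xcoord O U V r| < Num.min del 1 /\ `|ycoord O U V r| < Num.min del 1.
  by near: r; exact: near_origin.
rewrite !lt_min => /andP[x1 x2] /andP[y1 y2].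
have nbox := near_box del0 x1 y1.
have xpos (f : 'cV[R]_2 -> R) : continuous f -> 0 < f r -> \forall s \near r, 0 < f s.
  by move=> cf f0; have := cf r => /cvgr_gt; apply.
split.
  move=> [cA nA].
  have fnonneg (f : 'cV[R]_2 -> R) : continuous f ->
      (forall s, `|xcoord O U V s| < del -> `|ycoord O U V s| < del -> A s -> 0 < f s) ->
      0 <= f r.
    move=> cf fA; rewrite leNgt; apply/negP => fr.
    have [] := cA [set s | f s < 0 /\ (`|xcoord O U V s| < del /\ `|ycoord O U V s| < del)].
      by apply: filterI => //; have := cf r => /cvgr_lt; apply.
    by move=> s [As [fs [xs ys]]]; have := fA s xs ys As; lra.
  have x0 : 0 <= xcoord O U V r.
    by apply: fnonneg => [|s xs ys /hA []//]; exact: xcoord_continuous.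
  have y0 : 0 <= ycoord O U V r.
    by apply: fnonneg => [|s xs ys /hA []//]; exact: ycoord_continuous.
  have [xx|xx] : xcoord O U V r = 0 \/ 0 < xcoord O U V r by lra.
    exists (ycoord O U V r); first by move: y2; rewrite ltr_norml; lra.
    by right; rewrite {1}(frame_decomp r) xx scale0r addr0.
  have [yy|yy] : ycoord O U V r = 0 \/ 0 < ycoord O U V r by lra.
    exists (xcoord O U V r); first by move: x2; rewrite ltr_norml; lra.
    by left; rewrite {1}(frame_decomp r) yy scale0r addr0.
  case: nA; rewrite /interior /=; near=> s; apply/hA.
  - by near: s; apply: filterS nbox => s [].
  - by near: s; apply: filterS nbox => s [].
  split; near: s; apply: xpos => //.
    exact: xcoord_continuous.
  exact: ycoord_continuous.
move=> [t t01 rE].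
have [x0 y0 xy0] : [/\ 0 <= xcoord O U V r, 0 <= ycoord O U V r &
    xcoord O U V r = 0 \/ ycoord O U V r = 0].
  case: rE => ->;
    have := (xcoord_comb t 0, ycoord_comb t 0, (xcoord_comb 0 t, ycoord_comb 0 t)).
    rewrite !scale0r !addr0 => -[[-> ->] _]; split=> //; [lra|by right].
  rewrite !scale0r !addr0 => -[_ [-> ->]]; split=> //; [lra|by left].
split.
  apply: closure_sector => //; near=> s => xs ys; apply/hA.
  - by near: s; apply: filterS nbox => s [].
  - by near: s; apply: filterS nbox => s [].
  - by [].
move=> iA; have /hA [//|//|] : A r by exact: nbhs_singleton iA.
by case: xy0 => ->; rewrite ltxx => -[].
Unshelve. all: by end_near. Qed.

End FixedFrame.
End Frames.

(** * The patch at a corner and its relation to [Ftilde] *)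

Section PatchFrames.
Variable R : realType.
Implicit Types (O U V E r : 'cV[R]_2) (a b eps : R).

(** Recentred at (a, b), the map is again bilinear, with edges U + b E and V + a E and the same
    twist; the new frame has determinant det2 U V times the Jacobian, so [bcoord_solve] applies. *)
Lemma bilpt_open O U V E a b eps : det2 U V != 0 ->
  bjac (det2 E V / det2 U V) (det2 U E / det2 U V) a b != 0 -> 0 < eps ->
  \forall s \near bilpt O U V E a b, exists x y,
    [/\ `|x| < eps, `|y| < eps & s = bilpt O U V E (a + x) (b + y)].
Proof.
move=> d0 J0 eps0; pose U' := U + b *: E; pose V' := V + a *: E.
have d' : det2 U' V' = det2 U V * bjac (det2 E V / det2 U V) (det2 U E / det2 U V) a b.
  by rewrite /bjac; move: d0; rewrite !det2E !mxE => d0; field.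
have d'0 : det2 U' V' != 0 by rewrite d' mulf_neq0.
pose r := bilpt O U V E a b.
have [del del0 hdel] := bcoord_solve (det2 E V' / det2 U' V') (det2 U' E / det2 U' V') eps0.
near=> s.
have [h1 h2] : `|xcoord r U' V' s| < del /\ `|ycoord r U' V' s| < del.
  by near: s; exact: near_origin.
have [x [y [hx hy E1 E2]]] := hdel _ _ h1 h2; exists x, y; split=> //.
apply: (@frame_inj _ r _ _ d'0).
  rewrite -E1 -(xcoord_bilpt r d'0); congr xcoord.
  by rewrite /r /U' /V' /bilpt; apply: col2P; rewrite !mxE; ring.
rewrite -E2 -(ycoord_bilpt r d'0); congr ycoord.
by rewrite /r /U' /V' /bilpt; apply: col2P; rewrite !mxE; ring.
Unshelve. all: by end_near. Qed.

Lemma Z4_ind (P : 'Z_4 -> Prop) : P 0 -> P 1 -> P 2 -> P 3 -> forall k, P k.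
Proof.
move=> p0 p1 p2 p3 [[|[|[|[|//]]]] h].
- by rewrite (_ : Ordinal h = 0)//; exact: val_inj.
- by rewrite (_ : Ordinal h = 1)//; exact: val_inj.
- by rewrite (_ : Ordinal h = 2)//; exact: val_inj.
- by rewrite (_ : Ordinal h = 3)//; exact: val_inj.
Qed.

Lemma Z4E : ((((1 + 1)%R = 2 :> 'Z_4) * ((1 + 2)%R = 3 :> 'Z_4) * ((1 + 3)%R = 0 :> 'Z_4)) *
  (((2 + 1)%R = 3 :> 'Z_4) * ((2 + 2)%R = 0 :> 'Z_4) * ((2 + 3)%R = 1 :> 'Z_4)) *
  (((3 + 1)%R = 0 :> 'Z_4) * ((3 + 2)%R = 1 :> 'Z_4) * ((3 + 3)%R = 2 :> 'Z_4)) *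
  (4%R = 0 :> 'Z_4))%type.
Proof. by do !split; apply: val_inj. Qed.

Section Patch.
Variable X : 'Z_4 -> 'cV[R]_2.

(** The index k + 3 is k - 1, so the two edges lead to the neighbours of X k; [twist] measures the
    deviation from a parallelogram. *)
Definition edge1 (k : 'Z_4) : 'cV[R]_2 := X (k + 1) - X k.
Definition edge2 (k : 'Z_4) : 'cV[R]_2 := X (k + 3) - X k.
Definition twist (k : 'Z_4) : 'cV[R]_2 := X k - X (k + 1) + X (k + 2) - X (k + 3).
Definition edet k := det2 (edge1 k) (edge2 k).
(* [1 + tw1 k], [1 + tw2 k] and [1 + tw1 k + tw2 k] are the Jacobians at the
   corners k - 1, k + 1 and k + 2 divided by the Jacobian [edet k] at the corner
   k; the Jacobian at the corner k is [turn X (k - 1)]. *)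
Definition tw1 k := det2 (twist k) (edge2 k) / edet k.
Definition tw2 k := det2 (edge1 k) (twist k) / edet k.
Definition patch k a b := bilpt (X k) (edge1 k) (edge2 k) (twist k) a b.
Definition pjac k a b := bjac (tw1 k) (tw2 k) a b.

(** The determinant [turn X i] is centred at X (i + 1), whence the shift by 3 = -1. *)
Lemma turn_edet k : turn X (k + 3) = edet k.
Proof.
by rewrite /turn /edet /edge1 /edge2 -!addrA !Z4E !addr0 !det2E !mxE; ring.
Qed.

Lemma mul_edet_tw k c1 c2 : edet k != 0 -> edet k * (1 + tw1 k * c1 + tw2 k * c2) =
  edet k + det2 (twist k) (edge2 k) * c1 + det2 (edge1 k) (twist k) * c2.
Proof. by move=> d0; rewrite /tw1 /tw2; field. Qed.

Lemma turn_next k : edet k != 0 -> turn X k = edet k * (1 + tw2 k).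
Proof.
move=> d0; have := mul_edet_tw 0 1 d0; rewrite !mulr0 !mulr1 !addr0 => ->.
by rewrite /edet /turn /edge1 /edge2 /twist !det2E !mxE; ring.
Qed.

Lemma turn_prev k : edet k != 0 -> turn X (k + 2) = edet k * (1 + tw1 k).
Proof.
move=> d0; have := mul_edet_tw 1 0 d0; rewrite !mulr0 !mulr1 !addr0 => ->.
by rewrite /edet /turn /edge1 /edge2 /twist -!addrA !Z4E !addr0 !det2E !mxE; ring.
Qed.

Lemma turn_opp k : edet k != 0 -> turn X (k + 1) = edet k * (1 + tw1 k + tw2 k).
Proof.
move=> d0; have := mul_edet_tw 1 1 d0; rewrite !mulr1 => ->.
by rewrite /edet /turn /edge1 /edge2 /twist -!addrA !Z4E !det2E !mxE; ring.
Qed.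

(** A quarter turn of the parameter square: what is near (1, 0) from corner k is near (0, 0) from
    corner k + 1. *)
Lemma patch_next k a b : patch (k + 1) b (1 - a) = patch k a b.
Proof.
rewrite /patch /edge1 /edge2 /twist -!addrA !Z4E !addr0.
by rewrite /bilpt; apply: col2P; rewrite !mxE; ring.
Qed.

Lemma patch_opp_corner k : patch k 1 1 = X (k + 2).
Proof.
rewrite /patch /edge1 /edge2 /twist.
by rewrite /bilpt; apply: col2P; rewrite !mxE; ring.
Qed.

(** X 3 sits at p = (-1, -1), so [Ftilde] is the patch of corner 3 at the halved coordinates (1 +
    p.1) / 2 and (1 + p.2) / 2; the two halvings give 1/4. *)
Lemma det_DFtilde p : \det (DFtilde X p) =
  det2 (edge1 3 + ((1 + p.2) / 2) *: twist 3) (edge2 3 + ((1 + p.1) / 2) *: twist 3) / 4.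
Proof.
rewrite /DFtilde.
have -> : (fun s => Ftilde X (s, p.2)) = (fun s => Ftilde X (0, p.2) +
    s *: (2^-1 *: (edge1 3 + ((1 + p.2) / 2) *: twist 3))).
  apply/funext => s; rewrite /Ftilde /edge1 /twist !Z4E /=.
  by apply: col2P; rewrite !mxE; field.
have -> : (fun s => Ftilde X (p.1, s)) = (fun s => Ftilde X (p.1, 0) +
    s *: (2^-1 *: (edge2 3 + ((1 + p.1) / 2) *: twist 3))).
  apply/funext => s; rewrite /Ftilde /edge2 /twist !Z4E /=.
  by apply: col2P; rewrite !mxE; field.
by rewrite !derive1_line -/(det2 _ _) !det2E !mxE; field.
Qed.

(** The chart h rotates the square by a multiple of a quarter turn and halves it, sending the vertex
    that carries X k to (0, 0). It preserves orientation, so signs of Jacobians agree in all four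
    frames. *)
Lemma frame_param k : edet k != 0 -> exists h g : R * R -> R * R,
  [/\ cancel h g, cancel g h,
      forall p, square p <-> 0 < (h p).1 < 1 /\ 0 < (h p).2 < 1,
      forall p, Ftilde X p = patch k (h p).1 (h p).2 &
      forall p, \det (DFtilde X p) = edet k * pjac k (h p).1 (h p).2 / 4].
Proof.
have sqE (p : R * R) : square p <-> (-1 < p.1 < 1 /\ -1 < p.2 < 1).
  by rewrite /square /= !in_itv.
move: k; apply: Z4_ind => d0.
- exists (fun p => ((1 + p.2) / 2, (1 - p.1) / 2)), (fun q => (1 - 2 * q.2, 2 * q.1 - 1)).
  split=> [[u v]|[u v]|p|p|p].
  + by congr pair => /=; field.
  + by congr pair => /=; field.
  + by rewrite sqE /=; split=> -[]; split; lra.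
  + rewrite /Ftilde /patch /bilpt /edge1 /edge2 /twist ?add0r !Z4E /=.
    by apply: col2P; rewrite !mxE; field.
  + rewrite /pjac /bjac mul_edet_tw// det_DFtilde /edet /edge1 /edge2 /twist ?add0r !Z4E /=.
    by rewrite !det2E !mxE; field.
- exists (fun p => ((1 - p.1) / 2, (1 - p.2) / 2)), (fun q => (1 - 2 * q.1, 1 - 2 * q.2)).
  split=> [[u v]|[u v]|p|p|p].
  + by congr pair => /=; field.
  + by congr pair => /=; field.
  + by rewrite sqE /=; split=> -[]; split; lra.
  + rewrite /Ftilde /patch /bilpt /edge1 /edge2 /twist ?add0r !Z4E /=.
    by apply: col2P; rewrite !mxE; field.
  + rewrite /pjac /bjac mul_edet_tw// det_DFtilde /edet /edge1 /edge2 /twist ?add0r !Z4E /=.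
    by rewrite !det2E !mxE; field.
- exists (fun p => ((1 - p.2) / 2, (1 + p.1) / 2)), (fun q => (2 * q.2 - 1, 1 - 2 * q.1)).
  split=> [[u v]|[u v]|p|p|p].
  + by congr pair => /=; field.
  + by congr pair => /=; field.
  + by rewrite sqE /=; split=> -[]; split; lra.
  + rewrite /Ftilde /patch /bilpt /edge1 /edge2 /twist ?add0r !Z4E /=.
    by apply: col2P; rewrite !mxE; field.
  + rewrite /pjac /bjac mul_edet_tw// det_DFtilde /edet /edge1 /edge2 /twist ?add0r !Z4E /=.
    by rewrite !det2E !mxE; field.
- exists (fun p => ((1 + p.1) / 2, (1 + p.2) / 2)), (fun q => (2 * q.1 - 1, 2 * q.2 - 1)).
  split=> [[u v]|[u v]|p|p|p].
  + by congr pair => /=; field.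
  + by congr pair => /=; field.
  + by rewrite sqE /=; split=> -[]; split; lra.
  + rewrite /Ftilde /patch /bilpt /edge1 /edge2 /twist ?add0r !Z4E /=.
    by apply: col2P; rewrite !mxE; field.
  + rewrite /pjac /bjac mul_edet_tw// det_DFtilde /edet /edge1 /edge2 /twist ?add0r !Z4E /=.
    by rewrite !det2E !mxE; field.
Qed.

End Patch.
End PatchFrames.

(** * Preimage counts, the fold and the homeomorphic region *)

Section Regions.
Variable R : realType.
Implicit Types (O U V E r : 'cV[R]_2) (a b eps : R).
Variable X : 'Z_4 -> 'cV[R]_2.
Hypothesis X0 : forall i, turn X i != 0.

Lemma edet_neq0 k : edet X k != 0.
Proof. by rewrite -turn_edet. Qed.

Lemma card_set_pair (T : eqType) (p q : T) : p != q -> ([set p; q] #= `I_2)%card.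
Proof.
move=> pq; apply/card_set_bijP; exists (fun x => (x != p) : nat); split.
- by move=> x _ /=; case: (_ != _).
- move=> x y; rewrite !in_setE => -[->|->] [->|->] //=.
    by rewrite eqxx eq_sym pq.
  by rewrite eqxx eq_sym pq.
- move=> [|[|//]] _ /=.
    by exists p; [left|rewrite eqxx].
  by exists q; [right|rewrite eq_sym pq].
Qed.

Lemma card_eq1_set (T : Type) (A : set T) : (A #= `I_1)%card ->
  exists2 p, A p & forall q, A q -> q = p.
Proof.
move=> /card_set_bijP[f [f1 finj fsurj]].
have [p Ap _] := fsurj 0%N isT; exists p => // q Aq.
apply: finj; rewrite ?in_setE//.
by have := f1 _ Ap; have := f1 _ Aq; rewrite /=; case: (f p) => //; case: (f q).
Qed.

Lemma Stilde_patch k r : Stilde X r <->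
  exists a b, [/\ 0 < a < 1, 0 < b < 1 & r = patch X k a b].
Proof.
have [h [g [hg gh sq F _]]] := frame_param (edet_neq0 k).
split=> [[p /sq[p1 p2] <-]|[a [b [ha hb ->]]]].
  by exists (h p).1, (h p).2; rewrite -F.
by exists (g (a, b)); rewrite ?F ?gh//; apply/sq; rewrite gh.
Qed.

Lemma patch_eqP k a b a' b' : patch X k a' b' = patch X k a b <->
  bcoord (tw1 X k) a' b' = bcoord (tw1 X k) a b /\
  bcoord (tw2 X k) b' a' = bcoord (tw2 X k) b a.
Proof.
have d0 := edet_neq0 k; rewrite /tw1 /tw2 -!(xcoord_bilpt (X k) d0) -!(ycoord_bilpt (X k) d0).
by rewrite -!/(patch _ _ _ _); split=> [->//|[]]; exact: frame_inj.
Qed.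

Lemma buniq_patch k a b : buniq (tw1 X k) (tw2 X k) a b <->
  (forall a' b', 0 < a' < 1 -> 0 < b' < 1 -> patch X k a' b' = patch X k a b ->
   a' = a /\ b' = b).
Proof.
split=> u a' b' ha hb; first by move/patch_eqP => []; exact: u.
by move=> h1 h2; apply: u => //; apply/patch_eqP.
Qed.

Lemma preimages1 k a b : 0 < a < 1 -> 0 < b < 1 ->
  (preimages X (patch X k a b) #= `I_1)%card <-> buniq (tw1 X k) (tw2 X k) a b.
Proof.
move=> ha hb; have [h [g [hg gh sq F _]]] := frame_param (edet_neq0 k).
have memP a' b' : 0 < a' < 1 -> 0 < b' < 1 -> patch X k a' b' = patch X k a b ->
    preimages X (patch X k a b) (g (a', b')).
  by move=> ha' hb' e; split; [apply/sq|rewrite /= F]; rewrite gh.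
rewrite buniq_patch; split=> [/card_eq1_set[p _ pu] a' b' ha' hb' e|u].
  have := pu _ (memP _ _ ha hb erefl); rewrite -(pu _ (memP _ _ ha' hb' e)).
  by move=> /(can_inj gh)[].
rewrite (_ : preimages _ _ = [set g (a, b)]); first exact: card_set1.
apply/seteqP; split=> [p [/sq[p1 p2]]|p ->]; last exact: memP.
rewrite /= F => /u[] // e1 e2.
by rewrite -[p]hg; congr g; case: (h p) e1 e2 => /= ? ? -> ->.
Qed.

Lemma preimages2 k a b a' b' : 0 < a < 1 -> 0 < b < 1 -> 0 < a' < 1 -> 0 < b' < 1 ->
  a != a' -> patch X k a' b' = patch X k a b ->
  (forall a2 b2, 0 < a2 < 1 -> 0 < b2 < 1 -> patch X k a2 b2 = patch X k a b ->
    ~ (a2 = a /\ b2 = b) -> a2 = a' /\ b2 = b') ->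
  Sn X (patch X k a b).
Proof.
move=> ha hb ha' hb' aa e u.
have [h [g [hg gh sq F _]]] := frame_param (edet_neq0 k).
split; first by apply/(Stilde_patch k); exists a, b.
rewrite (_ : preimages _ _ = [set g (a, b); g (a', b')]).
  by apply: card_set_pair; rewrite (can_eq gh) xpair_eqE (negbTE aa).
apply/seteqP; split=> [p [/sq[p1 p2]]|p [->|->]]; last 2 first.
- by split; [apply/sq|rewrite /= F]; rewrite gh.
- by split; [apply/sq|rewrite /= F]; rewrite gh.
rewrite /= F => E; have [[e1 e2]|ne] := pselect ((h p).1 = a /\ (h p).2 = b).
  by left; rewrite /= -[p]hg; congr g; case: (h p) e1 e2 => /= ? ? -> ->.
have [e1 e2] := u _ _ p1 p2 E ne.
by right; rewrite /= -[p]hg; congr g; case: (h p) e1 e2 => /= ? ? -> ->.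
Qed.

Lemma near_unit a c : 0 < a < 1 -> \forall t \near (0 : R)^'+, 0 < a + t / c < 1.
Proof.
move=> /andP[a0 a1].
have cv : a + t / c @[t --> (0:R)^'+] --> a.
  apply: cvg_at_right_filter; rewrite -[X in _ --> X]addr0.
  apply: cvgD; first exact: cvg_cst.
  by rewrite -[X in _ --> X](mul0r c^-1); apply: cvgMr_tmp; exact: cvg_id.
near=> t; apply/andP; split; near: t; first exact: (cvgr_gt _ cv).
exact: (cvgr_lt _ cv).
Unshelve. all: by end_near. Qed.

(* At a point of the fold the discriminant [bcoord_disc] vanishes and changes
   sign. *)
Lemma fold_parabolic k a b : 0 < a < 1 -> 0 < b < 1 -> pjac X k a b = 0 ->
  buniq (tw1 X k) (tw2 X k) a b -> parabolic_line X (patch X k a b).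
Proof.
move=> ha hb J0 u; have d0 := edet_neq0 k.
have [e0 f0] := fold_neq0 ha hb J0 u.
move: (J0); rewrite /pjac.
set e := tw1 X k in e0 u *; set f := tw2 X k in f0 u * => J1.
set r := patch X k a b.
(* By [fold_pair], t^2 w is the common displacement of the images of the two parameters t and -
   t. *)
pose w := f^-1 *: edge1 X k + e^-1 *: edge2 X k.
have rw t : xcoord (X k) (edge1 X k) (edge2 X k) (r + t *: w) = bcoord e a b + t / f /\
    ycoord (X k) (edge1 X k) (edge2 X k) (r + t *: w) = bcoord f b a + t / e.
  rewrite (frame_decomp (X k) d0 r) /r xcoord_bilpt// ycoord_bilpt//.
  rewrite -/(tw1 X k) -/(tw2 X k) -/e -/f.
  have -> x y : X k + x *: edge1 X k + y *: edge2 X k + t *: w =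
     X k + (x + t / f) *: edge1 X k + (y + t / e) *: edge2 X k.
    by apply: col2P; rewrite !mxE; ring.
  by rewrite xcoord_comb// ycoord_comb.
have cw (s : R) : r + (s * t ^+ 2) *: w @[t --> (0:R)^'+] --> r.
  apply: cvg_at_right_filter; rewrite -[X in _ --> X]addr0.
  apply: cvgD; first exact: cvg_cst.
  rewrite -[X in _ --> X](scale0r w); apply: cvgZr_tmp.
  rewrite -[X in _ --> X](mulr0 s); apply: cvgMl_tmp.
  by rewrite -[X in _ --> X](expr0n R 2); apply: exprn_continuous.
have St : Stilde X r by apply/(Stilde_patch k); exists a, b.
split; split.
(* r is a limit of points of [Sn]: r + t^2 w has exactly the preimages (a + t / f, b + t / e) and (a
   - t / f, b - t / e). *)
- move=> B rB.
  have /filter_ex[t [t0 Bt [h1 h2 h3 h4]]] : \forall t \near (0:R)^'+,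
    [/\ 0 < t, B (r + (1 * t ^+ 2) *: w) &
     [/\ 0 < a + t / f < 1, 0 < b + t / e < 1, 0 < a + t / - f < 1 & 0 < b + t / - e < 1]].
    near=> t; split; [|by near: t; exact: (cw 1 _ rB)|split].
    + by near: t; exact: nbhs_right_gt.
    + by near: t; exact: near_unit.
    + by near: t; exact: near_unit.
    + by near: t; exact: near_unit.
    + by near: t; exact: near_unit.
  have [E1 E2 E3] := fold_pair t e0 f0 J1.
  have [F1 F2 _] := fold_pair (- t) e0 f0 J1.
  have rE : r + (1 * t ^+ 2) *: w = patch X k (a + t / f) (b + t / e).
    have [G1 G2] := rw (1 * t ^+ 2); apply: (frame_inj (O := X k) d0).
      by rewrite G1 xcoord_bilpt// -/(tw1 X k) -/e E1 mul1r.
    by rewrite G2 ycoord_bilpt// -/(tw2 X k) -/f E2 mul1r.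
  exists (r + (1 * t ^+ 2) *: w); split=> //; rewrite rE.
  have J2 : bjac e f (a + t / f) (b + t / e) != 0.
    by rewrite E3 mulf_neq0 ?gt_eqF.
  apply: (preimages2 (a' := a - t / f) (b' := b - t / e)) => //.
  + by move: h3; rewrite invrN mulrN.
  + by move: h4; rewrite invrN mulrN.
  + apply/eqP => /addrI /eqP; rewrite -subr_eq0 opprK -mulr2n mulrn_eq0/=.
    by rewrite mulf_eq0 invr_eq0 (negbTE f0) gt_eqF.
  + apply/patch_eqP; rewrite -/e -/f -mulNr -[- (t / e)]mulNr.
    by rewrite F1 F2 E1 E2 sqrrN.
  + move=> a2 b2 _ _ /patch_eqP[]; rewrite -/e -/f => G1 G2 ne.
    have [_ _ H1 H2] := mirrorP G1 G2 J2 ne.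
    have Ee : e * (t / e) = t by rewrite mulrC divfK.
    have Ff : f * (t / f) = t by rewrite mulrC divfK.
    move: J1 H1 H2; rewrite /bjac !mulrDr Ee Ff => J1 H1 H2.
    split; first by apply: (mulfI f0); rewrite mulrBr Ff; lra.
    by apply: (mulfI e0); rewrite mulrBr Ee; lra.
- move=> /nbhs_singleton[_]; have := (preimages1 k ha hb).2 u.
  by move=> c1 c2; move: c2; rewrite (card_eql c1) => /card_eq_II.
- exact: subset_closure.
(* r is not interior to the region: at r - t^2 w the discriminant would be - 4 t^2, yet it must be a
   square. *)
- move=> iS; have /filter_ex[t [t0]] : \forall t \near (0:R)^'+,
      0 < t /\ Stilde X (r + (-1 * t ^+ 2) *: w).
    by near=> t; split; near: t; [exact: nbhs_right_gt|exact: (cw (-1) _ iS)].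
  move=> /(Stilde_patch k)[a1 [b1 [_ _ E]]].
  have [] := rw (-1 * t ^+ 2); rewrite E xcoord_bilpt// ycoord_bilpt//.
  rewrite -/(tw1 X k) -/(tw2 X k) -/e -/f => G1 G2.
  have := bcoord_disc e f a1 b1; rewrite G1 G2.
  have := bcoord_disc e f a b; rewrite J1.
  have -> : 1 + e * (bcoord f b a + -1 * t ^+ 2 / e) - f * (bcoord e a b + -1 * t ^+ 2 / f) =
    1 + e * bcoord f b a - f * bcoord e a b by field; rewrite ?e0 ?f0.
  have -> : 4 * f * (bcoord e a b + -1 * t ^+ 2 / f) = 4 * f * bcoord e a b - 4 * t ^+ 2.
    by field.
  have : 0 < t ^+ 2 by rewrite exprn_gt0.
  have := sqr_ge0 (bjac e f a1 b1).
  rewrite expr0n /=; lra.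
Unshelve. all: by end_near. Qed.

Lemma patch_interior k a b : 0 < a < 1 -> 0 < b < 1 -> pjac X k a b != 0 ->
  interior (Stilde X) (patch X k a b).
Proof.
move=> ha hb J0; pose eps := Num.min (Num.min a (1 - a)) (Num.min b (1 - b)).
have eps0 : 0 < eps by rewrite !lt_min; lra.
have := bilpt_open (X k) (edet_neq0 k) J0 eps0; apply: filterS => s.
move=> [x [y [hx hy ->]]]; apply/(Stilde_patch k); exists (a + x), (b + y).
move: hx hy; rewrite !lt_min !ltr_norml => /andP[/andP[x1 x2] _] /andP[_ /andP[y1 y2]].
by split=> //; lra.
Qed.

(** A unique preimage with zero Jacobian is on the parabolic line by [fold_parabolic]; conversely a
    regular point is interior to [Stilde X], hence off its boundary. *)
Lemma ShP k r : Sh X r <-> exists a b, [/\ 0 < a < 1, 0 < b < 1,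
  r = patch X k a b, pjac X k a b != 0 & buniq (tw1 X k) (tw2 X k) a b].
Proof.
split.
  move=> [[/(Stilde_patch k)[a [b [ha hb ->]]] npar] /(preimages1 k ha hb) u].
  exists a, b; split=> //; apply/eqP => J0; apply: npar.
  exact: fold_parabolic.
move=> [a [b [ha hb -> J0 u]]]; split; last exact/preimages1.
split; first by apply/(Stilde_patch k); exists a, b.
by move=> [_ [_]]; apply; exact: patch_interior.
Qed.

End Regions.

(** * Corners of a subregion *)

Section Components.
Variable R : realType.
Implicit Types (O U V E r : 'cV[R]_2) (a b t eps del : R) (A T : set 'cV[R]_2).

Lemma bcoord_near0 (e : R) del : 0 < del -> exists2 eps, 0 < eps &
  forall a b, 0 < a < eps -> 0 < b < eps -> `|bcoord e a b| < del.
Proof.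
move=> del0; have [c /andP[c0 cd] hc] :=
  exists_small (normr_ge0 e) (divr_gt0 del0 (ltr0n _ 2)).
exists c => // a b ha hb; rewrite /bcoord normrM gtr0_norm; last by lra.
have : - 8^-1 <= e * b <= 8^-1.
  by apply: (norm_mul_le8 hc); rewrite gtr0_norm; lra.
move=> eb; rewrite gtr0_norm; last by lra.
have : 0 < a * (2 - (1 + e * b)) by apply: mulr_gt0; lra.
by lra.
Qed.

Lemma corner_boundary A r : corner A r -> boundary A r.
Proof.
move=> [c1 [c2 [eps [eps0 [[_ <-] _] _ /nbhs_singleton h]]]].
by apply/h; exists 0; [rewrite lexx|left].
Qed.

Lemma conv_lt (x y z t : R) : x < z -> y < z -> 0 <= t <= 1 -> (1 - t) * x + t * y < z.
Proof.
move=> xz yz /andP[t0 t1]; have [->|t0'] := eqVneq t 0; first by lra.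
have : 0 < t * (z - y) by apply: mulr_gt0; rewrite ?lt0r ?t0'; lra.
have : 0 <= (1 - t) * (z - x) by apply: mulr_ge0; lra.
by lra.
Qed.

Lemma conv_gt (x y z t : R) : z < x -> z < y -> 0 <= t <= 1 -> z < (1 - t) * x + t * y.
Proof.
move=> xz yz ht; have := @conv_lt (- x) (- y) (- z) t.
by rewrite !ltrN2 => /(_ xz yz ht); lra.
Qed.

Lemma path_component A T r (c : R -> 'cV[R]_2) : T = connected_component A r ->
  continuous c -> (forall t, 0 <= t <= 1 -> A (c t)) -> T (c 0) -> T (c 1).
Proof.
move=> -> cc Ac T0; rewrite (same_connected_component T0).
have h01 : `[0, 1]%classic (0:R) /\ `[0, 1]%classic (1:R).
  by rewrite /= !in_itv /= !lexx !ler01.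
have [h0 h1] := h01.
have cI : connected (c @` `[0, 1]).
  apply: connected_continuous_connected; first exact: segment_connected.
  exact: continuous_subspaceT.
have sI : c @` `[0, 1] `<=` A.
  by move=> _ [t ht <-]; apply: Ac; move: ht; rewrite /= in_itv.
have I0 : (c @` `[0, 1]) (c 0) by exists 0.
by apply: (connected_component_max I0 sI cI); exists 1.
Qed.

Lemma bilpt_continuous O U V E (p q : R -> R) : continuous p -> continuous q ->
  continuous (fun t => bilpt O U V E (p t) (q t)).
Proof.
move=> cp cq t; apply: cvgD; last by apply: cvgZr_tmp; apply: cvgM; [exact: cp|exact: cq].
apply: cvgD; last by apply: cvgZr_tmp; exact: cq.
by apply: cvgD; [exact: cvg_cst|apply: cvgZr_tmp; exact: cp].
Qed.

Lemma line_continuous O U : continuous (fun t : R => O + t *: U).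
Proof. by move=> t; apply: cvgD; [exact: cvg_cst|apply: cvgZr_tmp; exact: cvg_id]. Qed.

Lemma affine_continuous (x y : R) : continuous (fun t : R => x + t * y).
Proof. by move=> t; apply: cvgD; [exact: cvg_cst|apply: cvgMr_tmp; exact: cvg_id]. Qed.

Variable X : 'Z_4 -> 'cV[R]_2.
Hypothesis X0 : forall i, turn X i != 0.
Let d0 k : edet X k != 0 := edet_neq0 X0 k.

Definition xpos k r := xcoord (X k) (edge1 X k) (edge2 X k) r.
Definition ypos k r := ycoord (X k) (edge1 X k) (edge2 X k) r.
(** At least one neighbouring corner has the Jacobian sign of corner k. *)
Definition good_corner k := -1 < tw1 X k \/ -1 < tw2 X k.

Lemma xpos_patch k a b : xpos k (patch X k a b) = bcoord (tw1 X k) a b.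
Proof. exact: (xcoord_bilpt _ (d0 k)). Qed.

Lemma ypos_patch k a b : ypos k (patch X k a b) = bcoord (tw2 X k) b a.
Proof. exact: (ycoord_bilpt _ (d0 k)). Qed.

Lemma good_corner_box k : good_corner k -> exists2 del, 0 < del & forall r,
  `|xpos k r| < del -> `|ypos k r| < del ->
  (Stilde X r <-> 0 < xpos k r /\ 0 < ypos k r) /\
  (0 < xpos k r /\ 0 < ypos k r -> Sh X r).
Proof.
move=> gk; have [del del0 hdel] := corner_coords gk.
exists del => // r xr yr; have [h1 h2] := hdel _ _ xr yr.
have h3 : 0 < xpos k r /\ 0 < ypos k r -> Sh X r.
  move=> [x0 y0]; have [a [b [ha hb E1 E2]]] := h1 x0 y0.
  have [_ _ J0 u] := h2 _ _ ha hb E1 E2.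
  apply/(ShP X0 k); exists a, b; split=> //; last exact: lt0r_neq0.
  apply: (frame_inj (O := X k) (d0 k)).
    by rewrite -/(xpos k r) -/(xpos k _) xpos_patch.
  by rewrite -/(ypos k r) -/(ypos k _) ypos_patch.
split=> //; split=> [/(Stilde_patch X0 k)[a [b [ha hb rE]]]|/h3[[]//]].
by have [] := h2 a b ha hb; rewrite rE ?xpos_patch ?ypos_patch.
Qed.

Lemma corner_Stilde k : good_corner k -> corner (Stilde X) (X k).
Proof.
move=> /good_corner_box[del del0 h].
by apply: (corner_sector (d0 k) del0) => r xr yr; have [] := h r xr yr.
Qed.

Lemma subregion_Sh T : subregion X T -> T `<=` Sh X.
Proof. by move=> [q _ ->]; exact: connected_component_sub. Qed.

(** In a box around X k the homeomorphic region is an open sector. Segments inside it connect its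
    points, so a component with points arbitrarily close to the corner coincides with the sector
    there. *)
Lemma good_corner_subregion k T : good_corner k -> subregion X T ->
  (forall eps, 0 < eps -> exists a b, [/\ 0 < a < eps, 0 < b < eps & T (patch X k a b)]) ->
  corner T (X k) /\
  exists2 eps, 0 < eps & forall a b, 0 < a < eps -> 0 < b < eps -> T (patch X k a b).
Proof.
move=> gk sT hT; have [del del0 h] := good_corner_box gk.
have [eps1 eps10 h1] := bcoord_near0 (tw1 X k) del0.
have [eps2 eps20 h2] := bcoord_near0 (tw2 X k) del0.
have Teps0 : 0 < Num.min (Num.min eps1 eps2) 1 by rewrite !lt_min eps10 eps20 ltr01.
have small a b : 0 < a < Num.min (Num.min eps1 eps2) 1 ->
    0 < b < Num.min (Num.min eps1 eps2) 1 ->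
    [/\ 0 < a < 1, 0 < b < 1, `|xpos k (patch X k a b)| < del &
        `|ypos k (patch X k a b)| < del].
  rewrite !lt_min => /and3P[a0 /andP[a1 a2] a3] /and3P[b0 /andP[b1 b2] b3].
  rewrite xpos_patch ypos_patch; split; rewrite ?a0 ?b0 //.
    by apply: h1; rewrite ?a0 ?b0.
  by apply: h2; rewrite ?a0 ?b0.
have [a0 [b0 [ha0 hb0 T0]]] := hT _ Teps0.
have [ha1 hb1 x0 y0] := small _ _ ha0 hb0.
set r0 := patch X k a0 b0 in T0 x0 y0.
have [[hS0 _] _] := h r0 x0 y0.
have [x0' y0'] : 0 < xpos k r0 /\ 0 < ypos k r0.
  by apply: hS0; apply/(Stilde_patch X0 k); exists a0, b0.
have Tsec r : `|xpos k r| < del -> `|ypos k r| < del -> T r <-> 0 < xpos k r /\ 0 < ypos k r.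
  move=> xr yr; have [hS hSh] := h r xr yr; split.
    by move=> /(subregion_Sh sT)[[/hS]].
  move=> [xr' yr']; have [q _ TE] := sT.
  have := @path_component _ _ _ (fun t => r0 + t *: (r - r0)) TE (@line_continuous _ _).
  rewrite scale0r addr0 scale1r (addrC r0 (r - r0)) subrK; apply=> // t ht.
  have xE : xpos k (r0 + t *: (r - r0)) = (1 - t) * xpos k r0 + t * xpos k r.
    by rewrite /xpos /xcoord !mulrA -mulrDl; congr (_ / _); rewrite !det2E !mxE; ring.
  have yE : ypos k (r0 + t *: (r - r0)) = (1 - t) * ypos k r0 + t * ypos k r.
    by rewrite /ypos /ycoord !mulrA -mulrDl; congr (_ / _); rewrite !det2E !mxE; ring.
  move: x0 y0 xr yr; rewrite !gtr0_norm// => x0 y0 xr yr.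
  have x1 : 0 < xpos k (r0 + t *: (r - r0)) by rewrite xE; exact: conv_gt.
  have y1 : 0 < ypos k (r0 + t *: (r - r0)) by rewrite yE; exact: conv_gt.
  have [] // := h (r0 + t *: (r - r0)).
  - by rewrite gtr0_norm// xE; exact: conv_lt.
  - by rewrite gtr0_norm// yE; exact: conv_lt.
  - by move=> _; apply.
split; first exact: (corner_sector (d0 k) del0).
exists (Num.min (Num.min eps1 eps2) 1) => // a b ha hb.
have [ha2 hb2 xr yr] := small _ _ ha hb.
have [[hS _] _] := h _ xr yr.
by apply/Tsec => //; apply: hS; apply/(Stilde_patch X0 k); exists a, b.
Qed.

(** Corner k + 1 has the Jacobian sign of corner k. Either k - 1 has it too (convex and concave
    cases), or k - 1 and k + 2 both have the opposite sign (crossed case). *)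
Definition base_corner k := -1 < tw2 X k /\
  (-1 < tw1 X k \/ (tw1 X k < -1 /\ 1 + tw1 X k + tw2 X k < 0)).

(** The Jacobian ratios between corners k and k + 1, taken in the two directions, are inverse to
    each other, hence both positive. *)
Lemma good_base_corner k : -1 < tw2 X k -> good_corner k /\ good_corner (k + 1).
Proof.
move=> f1; split; [by right|left].
have E1 := turn_next (d0 k); have E2 := turn_prev (d0 (k + 1)).
have E3 := turn_edet X (k + 1).
have i2 : k + 1 + 2 = k + 3 by rewrite -[LHS]addrA Z4E.
have i3 : k + 1 + 3 = k by rewrite -[LHS]addrA Z4E addr0.
move: E2; rewrite i2 turn_edet -E3 i3 E1 => E2.
have k1 : 0 < 1 + tw2 X k by lra.
have : 1 = (1 + tw2 X k) * (1 + tw1 X (k + 1)).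
  by apply: (mulfI (d0 k)); rewrite mulr1 mulrA.
move=> E; have : 0 < (1 + tw2 X k) * (1 + tw1 X (k + 1)) by rewrite -E.
by rewrite pmulr_rgt0//; lra.
Qed.

Lemma base_corner_pair k T a b : base_corner k -> subregion X T ->
  0 < a < 1 -> 0 < b < 1 -> T (patch X k a b) -> 0 < pjac X k a b ->
  corner_pair X T k.
Proof.
move=> [f1 ef] sT ha hb Tab J0; have [g1 g2] := good_base_corner f1.
have u : buniq (tw1 X k) (tw2 X k) a b.
  have /(ShP X0 k)[a' [b' [ha' hb' /(patch_eqP X0)[E1 E2] _ u]]] := subregion_Sh sT Tab.
  by have [-> ->] := u _ _ ha hb E1 E2.
have [q _ TE] := sT.
(* First leg of the path: the straight segment from (a, b) towards the corner (0, 0). *)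
have Tt t : 0 < t <= 1 -> T (patch X k (t * a) (t * b)).
  move=> ht; have := @path_component _ _ _
    (fun s => patch X k (a + s * ((t - 1) * a)) (b + s * ((t - 1) * b))) TE.
  rewrite !mul0r !addr0 !mul1r.
  have tE x : x + (t - 1) * x = t * x by ring.
  rewrite !tE; apply=> //; first by apply: bilpt_continuous; exact: affine_continuous.
  move=> s hs; have sE x : x + s * ((t - 1) * x) = ((1 - s) * 1 + s * t) * x by ring.
  rewrite !sE.
  have hst : 0 < (1 - s) * 1 + s * t <= 1.
    rewrite conv_gt ?ltr01//=; last by lra.
    have : 0 <= s * (1 - t) by apply: mulr_ge0; lra.
    by lra.
  have [u' J'] := segment_uniq f1 ef ha hb J0 u hst.
  apply/(ShP X0 k); eexists; eexists; split; [| |reflexivity| |exact: u'].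
  - by apply/andP; split; nra.
  - by apply/andP; split; nra.
  - exact: lt0r_neq0.
have [c1 [eps eps0 Teps]] : corner T (X k) /\ exists2 eps, 0 < eps &
    forall a b, 0 < a < eps -> 0 < b < eps -> T (patch X k a b).
  apply: good_corner_subregion => // eps eps0.
  have m0 : 0 < Num.min (eps / 2) 1 by rewrite lt_min ltr01 andbT; lra.
  have m1 : Num.min (eps / 2) 1 <= 1 by rewrite ge_min lexx orbT.
  have m2 : Num.min (eps / 2) 1 <= eps / 2 by rewrite ge_min lexx.
  exists (Num.min (eps / 2) 1 * a), (Num.min (eps / 2) 1 * b); split.
  - by apply/andP; split; nra.
  - by apply/andP; split; nra.
  - by apply: Tt; rewrite m0.
have [eta0 eta00 heta] := edge_uniq (tw1 X k) f1.
have [c2 _] : corner T (X (k + 1)) /\ exists2 eps, 0 < eps &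
    forall a b, 0 < a < eps -> 0 < b < eps -> T (patch X (k + 1) a b).
  apply: good_corner_subregion => // eps' eps'0.
  have m0 : 0 < Num.min (Num.min eps eta0) (Num.min eps' (1 / 2)).
    by rewrite !lt_min eps0 eta00 eps'0/=; lra.
  have [eta [eta1 eta2 eta3 eta4]] :
    exists eta, [/\ 0 < eta < eps, 0 < eta < eta0, 0 < eta < eps' & 0 < eta < 1 / 2].
    exists (Num.min (Num.min eps eta0) (Num.min eps' (1 / 2)) / 2).
    have := lexx (Num.min (Num.min eps eta0) (Num.min eps' (1 / 2))).
    by rewrite !le_min => /andP[/andP[? ?] /andP[? ?]]; split; lra.
  exists eta, eta; split=> //.
  (* Second leg: along the line of ordinate eta from (eta, eta) to (1 - eta, eta), which is (eta,
     eta) seen from corner k + 1. *)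
  rewrite -[X in patch _ _ _ X](subKr 1) patch_next.
  have := @path_component _ _ _
    (fun s => patch X k (eta + s * (1 - 2 * eta)) (eta + s * 0)) TE.
  rewrite !mul0r !mul1r !addr0.
  have -> : eta + (1 - 2 * eta) = 1 - eta by ring.
  apply; [by apply: bilpt_continuous; exact: affine_continuous| |exact: Teps].
  move=> s hs; rewrite mulr0 addr0.
  have hs1 : 0 < eta + s * (1 - 2 * eta) < 1.
    have : 0 <= s * (1 - 2 * eta) by apply: mulr_ge0; lra.
    have : 0 <= (1 - s) * (1 - 2 * eta) by apply: mulr_ge0; lra.
    by lra.
  have [u' J'] := heta _ _ eta2 hs1.
  apply/(ShP X0 k); eexists; eexists; split; [exact: hs1| |reflexivity| |exact: u'].
  - by lra.
  - exact: lt0r_neq0.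
by split=> //; exact: corner_Stilde.
Qed.

(** By [bad_corner], X (k + 2) is also the image of a regular point of the open square, so it is
    interior to the region. *)
Lemma reentrant_not_corner k : -1 < tw1 X k -> -1 < tw2 X k ->
  1 + tw1 X k + tw2 X k < 0 -> ~ corner (Stilde X) (X (k + 2)).
Proof.
move=> h1 h2 h3; have [a [b [ha hb J0 E1 E2]]] := bad_corner h1 h2 h3.
move=> /corner_boundary[_]; apply.
rewrite -patch_opp_corner (_ : patch X k 1 1 = patch X k a b).
  exact: patch_interior.
by apply/(patch_eqP X0); rewrite E1 E2 /bcoord !mulr1 !mul1r.
Qed.

(** On the homeomorphic region the affine function L of [crossed_sep] has the sign of the Jacobian
    and never vanishes. By connectedness it is positive on T, while it is negative at X (k + 2) and
    X (k + 3). *)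
Lemma crossed_corners k T a b : tw1 X k < -1 -> -1 < tw2 X k ->
  1 + tw1 X k + tw2 X k < 0 -> subregion X T ->
  T (patch X k a b) -> 0 < a < 1 -> 0 < b < 1 -> 0 < pjac X k a b ->
  ~ closure T (X (k + 2)) /\ ~ closure T (X (k + 3)).
Proof.
move=> h1 h2 h3 sT Tab ha hb J0.
pose L r := 1 + tw2 X k - tw2 X k * xpos k r + tw1 X k * ypos k r.
have LE a' b' : L (patch X k a' b') = 1 + tw1 X k * b' + (1 - a') * tw2 X k.
  by rewrite /L xpos_patch ypos_patch /bcoord; ring.
have cL : continuous L.
  move=> r; apply: cvgD; last by apply: cvgMl_tmp; exact: ycoord_continuous.
  apply: cvgB; first exact: cvg_cst.
  by apply: cvgMl_tmp; exact: xcoord_continuous.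
have sgn r : T r -> exists a' b', [/\ 0 < a' < 1, 0 < b' < 1, r = patch X k a' b' &
    (0 < pjac X k a' b' /\ 0 < L r) \/ (pjac X k a' b' < 0 /\ L r < 0)].
  move=> /(subregion_Sh sT)/(ShP X0 k)[a' [b' [ha' hb' -> J1 u]]].
  exists a', b'; split=> //; rewrite LE.
  have [s1 s2] := crossed_sep h1 h2 h3 ha' hb' u.
  by move: J1; rewrite neq_lt => /orP[J1|J1]; [right|left]; split=> //; auto.
have L0 : 0 < L (patch X k a b).
  have /(ShP X0 k)[a' [b' [ha' hb' /(patch_eqP X0)[E1 E2] _ u]]] := subregion_Sh sT Tab.
  have [aE bE] := u _ _ ha hb E1 E2; rewrite -aE -bE in u.
  by rewrite LE; have [s1 _] := crossed_sep h1 h2 h3 ha hb u; apply: s1.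
have iL : is_interval (L @` T).
  apply/connected_intervalP/connected_continuous_connected.
    by have [q _ ->] := sT; exact: component_connected.
  exact: continuous_subspaceT.
have posL r : T r -> 0 < L r.
  move=> Tr; have [a' [b' [_ _ _ [[]//|[_ Lr]]]]] := sgn r Tr.
  have [s Ts Ls] : (L @` T) 0.
    apply: (iL (L r) (L (patch X k a b))); [by exists r|by exists (patch X k a b)|].
    by rewrite !ltW.
  by have [? [? [_ _ _]]] := sgn s Ts; rewrite Ls ltxx => -[[]|[]].
have clL r : L r < 0 -> ~ closure T r.
  move=> Lr cT; have [] := cT [set s | L s < 0].
    by have := cL r => /cvgr_lt; apply.
  by move=> s [/posL h /= h']; lra.
split; apply: clL.
  by rewrite -patch_opp_corner LE; lra.
rewrite (_ : X (k + 3) = patch X k 0 1); first by rewrite LE; lra.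
by rewrite /patch /bilpt /edge1 /edge2 /twist; apply: col2P; rewrite !mxE; ring.
Qed.

End Components.

(** * Signs at the corners and stability of the sliding vector field *)

Section Stability.
Variable R : realType.

Lemma regularization_surj (f : R -> R) (y : R) : regularization f -> -1 < y < 1 ->
  exists t, f t = y.
Proof.
move=> [[_ [V [g [_ VT gf gd]]]] _ f1 fN1 _] /andP[y0 y1].
have fE : f = g by apply/funext => t; apply: gf; rewrite in_setE.
have cf : continuous f.
  move=> t; apply: differentiable_continuous; apply/derivable1_diffP.
  by rewrite fE; apply: (gd 0%N); exact: VT.
have [s sy] : exists s, y < f s by apply: (@filter_ex _ +oo%R); exact: (cvgr_gt _ f1).
have [s' sy'] : exists s, f s < y by apply: (@filter_ex _ -oo%R); exact: (cvgr_lt _ fN1).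
have [ss|ss] := leP s s'.
  have [|c _ <-] := @IVT R f s s' y ss (continuous_subspaceT cf); last by exists c.
  by rewrite ge_min le_max (ltW sy) (ltW sy') !orbT.
have [|c _ <-] := @IVT R f s' s y (ltW ss) (continuous_subspaceT cf); last by exists c.
by rewrite ge_min le_max (ltW sy) (ltW sy') !orbT.
Qed.

Lemma derive1_reg_inv_gt0 (f : R -> R) (y : R) : regularization f -> -1 < y < 1 ->
  0 < derive1 f (reg_inv f y).
Proof.
move=> rf hy; have [t ty] := regularization_surj rf hy.
have fK : f (reg_inv f y) = y.
  by apply: pinvK; rewrite in_setE; exists t; rewrite //= ty.
by case: rf => _ df _ _ _; apply: df; rewrite fK.
Qed.

(** The values s (k + 3), s k, s (k + 1), s (k + 2) belong to the corners k, k + 1, k + 2, k + 3.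
    The linear relation rules out alternating signs; otherwise three consecutive signs agree or
    there are two adjacent pairs. *)
Lemma turn_pattern (s : 'Z_4 -> R) : (forall i, s i != 0) ->
  s 0 + s 2 = s 1 + s 3 -> exists k,
  [\/ [/\ 0 < s (k + 3), 0 < s k & 0 < s (k + 2)],
      [/\ s (k + 3) < 0, s k < 0 & s (k + 2) < 0] |
      [/\ 0 < s (k + 3), 0 < s k, s (k + 1) < 0 & s (k + 2) < 0]].
Proof.
move=> s0 sE.
have h i : s i < 0 \/ 0 < s i by apply/orP; rewrite -neq_lt.
have [h0|h0] := h 0; have [h1|h1] := h 1; have [h2|h2] := h 2;
  have [h3|h3] := h 3;
  first [ lra
        | exists 0; rewrite ?add0r ?Z4E; first [by constructor 1|by constructor 2|by constructor 3]
        | exists 1; rewrite ?Z4E; first [by constructor 1|by constructor 2|by constructor 3]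
        | exists 2; rewrite ?Z4E; first [by constructor 1|by constructor 2|by constructor 3]
        | exists 3; rewrite ?Z4E; first [by constructor 1|by constructor 2|by constructor 3] ].
Qed.

Variable X : 'Z_4 -> 'cV[R]_2.

(** The positive and negative indices are disjoint and fill all four places. *)
Lemma turn_neq0 i : (4 <= npos X + nneg X)%N -> turn X i != 0.
Proof.
have -> : (npos X + nneg X = #|[pred i | (turn X i != 0)%R]|)%N.
  rewrite /npos /nneg -cardUI [X in (_ + X)%N]eq_card0 ?addn0.
    by apply: eq_card => j; rewrite !inE neq_lt orbC.
  by move=> j; rewrite !inE; apply/negbTE; rewrite negb_and -!leNgt le_total.
have := cardC [pred i | turn X i != 0]; rewrite card_ord => cE le4.
have : #|[predC [pred i | turn X i != 0]]| = 0%N.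
  by apply/eqP; rewrite -leqn0 -(leq_add2l #|[pred i | turn X i != 0]|) cE addn0.
by move=> /card0_eq /(_ i); rewrite !inE => /negbFE.
Qed.

Hypothesis X0 : forall i, turn X i != 0.
Let d0 k : edet X k != 0 := edet_neq0 X0 k.

(** [turn_pattern] is applied to the turns multiplied by the Jacobian D at the zero, so that a
    positive entry means the sign of D. *)
Lemma base_corner_exists T p : subregion X T -> T 0 -> square p -> Ftilde X p = 0 ->
  exists k a b, [/\ base_corner X k, 0 < \det (DFtilde X p) * edet X k &
    [/\ 0 < a < 1, 0 < b < 1, patch X k a b = 0 & 0 < pjac X k a b]].
Proof.
move=> sT T0 sp Fp; set D := \det _.
have loc k : exists a b, [/\ 0 < a < 1, 0 < b < 1, patch X k a b = 0,
    D = edet X k * pjac X k a b / 4 &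
    pjac X k a b != 0 /\ buniq (tw1 X k) (tw2 X k) a b].
  have [h [g [_ _ sq F J]]] := frame_param (d0 k).
  have /sq[p1 p2] := sp; exists (h p).1, (h p).2; split=> //; [by rewrite -F|exact: J|].
  have := subregion_Sh sT T0; rewrite -Fp F => /(ShP X0 k)[a [b [ha hb]]].
  move=> /(patch_eqP X0)[E1 E2] J1 u.
  by have [-> ->] := u _ _ p1 p2 E1 E2.
have D0 : D != 0.
  have [a [b [_ _ _ -> [J0 _]]]] := loc 0.
  by apply: mulf_neq0; [exact: mulf_neq0|rewrite invr_eq0 pnatr_eq0].
have tE : D * turn X 0 + D * turn X 2 = D * turn X 1 + D * turn X 3.
  rewrite -!mulrDr; congr (_ * _).
  by rewrite /turn ?add0r !Z4E !det2E !mxE; ring.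
have [k] := @turn_pattern (fun i => D * turn X i) (fun i => mulf_neq0 D0 (X0 i)) tE.
have [a [b [ha hb P0 DE [J0 u]]]] := loc k.
have DD : 0 < D * edet X k * pjac X k a b.
  have -> : D * edet X k * pjac X k a b = 4 * D ^+ 2 by rewrite DE expr2; field.
  by rewrite mulr_gt0// exprn_even_gt0.
rewrite turn_edet (turn_next (d0 k)) (turn_prev (d0 k)) (turn_opp (d0 k)) !mulrA => H.
exists k, a, b; case: H => [[h1]|[h1]|[h1]].
- rewrite !(pmulr_rgt0 _ h1) => h2 h3; split=> //.
    by split; [lra|left; lra].
  by split=> //; rewrite -(pmulr_rgt0 _ h1).
(* Three consecutive corners cannot have the sign opposite to D: [bjac_pos_of_uniq] would give D the
   sign of corner k. *)
- rewrite !(nmulr_rlt0 _ h1) => h2 h3; exfalso.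
  have : 0 < pjac X k a b by apply: bjac_pos_of_uniq => //; lra.
  by move: DD; rewrite (nmulr_rgt0 _ h1) => /ltW; rewrite leNgt => /negP.
- rewrite (pmulr_rgt0 _ h1) !(pmulr_rlt0 _ h1) => h2 h3 h4; split=> //.
    by split; [lra|right; lra].
  by split=> //; rewrite -(pmulr_rgt0 _ h1).
Qed.

Lemma Z4_cases (k l : 'Z_4) : [\/ l = k, l = k + 1, l = k + 2 | l = k + 3].
Proof.
have -> : l = k + (l - k) by rewrite addrC subrK.
by move: (l - k); apply: Z4_ind; rewrite ?addr0;
  [constructor 1|constructor 2|constructor 3|constructor 4].
Qed.

(** Relative to a base corner k, the corners k and k + 1 have the sign of D. A further corner of the
    opposite sign is either reentrant, so not a corner of [Stilde X], or across the separating line,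
    so outside the closure of T. *)
Lemma corner_turn T p l : subregion X T -> T 0 -> square p -> Ftilde X p = 0 ->
  corner T (X l) -> corner (Stilde X) (X l) ->
  0 < \det (DFtilde X p) * turn X (l + 3).
Proof.
move=> sT T0 sp Fp cT cS.
have [k [a [b [[f1 ef] Dk [ha hb P0 J0]]]]] := base_corner_exists sT T0 sp Fp.
have clT : closure T (X l) by have [] := corner_boundary cT.
have [] := Z4_cases k l => lE; rewrite lE.
- by rewrite turn_edet.
- rewrite -addrA Z4E addr0 (turn_next (d0 k)) mulrA pmulr_rgt0//; lra.
- rewrite -addrA Z4E (turn_opp (d0 k)) mulrA pmulr_rgt0//.
  case: ef => [e1|[e1 ef]].
    rewrite ltNge; apply/negP; rewrite le_eqVlt => /orP[/eqP e0|e0].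
      by have := X0 (k + 1); rewrite (turn_opp (d0 k)) e0 mulr0 eqxx.
    by apply: (reentrant_not_corner X0 e1 f1 e0); rewrite -lE.
  have [] := crossed_corners X0 e1 f1 ef sT _ ha hb J0; first by rewrite P0.
  by rewrite -lE.
- rewrite -addrA Z4E (turn_prev (d0 k)) mulrA pmulr_rgt0//.
  case: ef => [e1|[e1 ef]]; first lra.
  have [] := crossed_corners X0 e1 f1 ef sT _ ha hb J0; first by rewrite P0.
  by rewrite -lE.
Qed.

(** At a zero, X k = - (a U + b (V + a E)), so det2 (X k) (X k + U) = b det2 U (V + a E): b times
    the Jacobian at (a, 0), which interpolates those at the corners k and k + 1. *)
Lemma det2_edge k a b : patch X k a b = 0 ->
  det2 (X k) (X (k + 1)) = b * ((1 - a) * turn X (k + 3) + a * turn X k).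
Proof.
move=> P0; rewrite turn_edet (turn_next (d0 k)).
have -> : (1 - a) * edet X k + a * (edet X k * (1 + tw2 X k)) =
   edet X k * (1 + tw1 X k * 0 + tw2 X k * a) by ring.
rewrite mul_edet_tw// mulr0 addr0 /edet.
have -> : X (k + 1) = X k + edge1 X k by rewrite /edge1 [RHS]addrC subrK.
have -> : X k = - (a *: edge1 X k + b *: edge2 X k + (a * b) *: twist X k).
  by apply/eqP; rewrite -addr_eq0 !addrA; apply/eqP; exact: P0.
by rewrite !det2E !mxE; ring.
Qed.

Lemma det_Jac psi phi p : \det (Jac X psi phi p) = \det (DFtilde X p) *
  (derive1 psi (reg_inv psi p.1) * derive1 phi (reg_inv phi p.2)).
Proof.
rewrite /Jac det_mulmx det_diag; congr (_ * _).
by rewrite !big_ord_recl big_ord0 mulr1 !mxE.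
Qed.

End Stability.

Theorem proposition8 (R : realType) (I : interval R)
    (alpha beta gamma : 'Z_4 -> R -> R)
    (smooth_fields : forall i, [/\ smooth_on [set` I] (alpha i),
                                   smooth_on [set` I] (beta i) &
                                   smooth_on [set` I] (gamma i)])
    (x : R) (x_in_I : x \in I) :
  let X := yz_field beta gamma x in
  convex_projection X \/ crossed_projection X \/ concave_projection X ->
  forall T : set 'cV[R]_2, subregion X T -> T 0 ->
  (exists k : 'Z_4, corner_pair X T k) /\
  (forall k : 'Z_4, corner_pair X T k ->
   forall psi phi : R -> R, regularization psi -> regularization phi ->
   forall (p : R * R) (v : R), sliding_vector_field alpha beta gamma x p v ->
   (0 < det2 (X k) (X (k + 1)) -> node_focus_center_type (Jac X psi phi p)) /\
   (det2 (X k) (X (k + 1)) < 0 -> saddle_type (Jac X psi phi p))).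
Proof.
move=> X classX T sT T0.
have X0 i : turn X i != 0.
  apply: turn_neq0; case: classX => [[->|->]|[[-> ->]|[[-> ->]|[-> ->]]]] //.
  exact: leq_addl.
split.
  have [[[p sp Fp] _] _] := subregion_Sh sT T0.
  have [k [a [b [bk _ [ha hb P0 J0]]]]] := base_corner_exists X0 sT T0 sp Fp.
  exists k; apply: (base_corner_pair X0 bk sT ha hb _ J0).
  by rewrite P0.
move=> k [cT1 cT2 cS1 cS2] psi phi rpsi rphi p v [sp Fp _].
have s1 := corner_turn X0 sT T0 sp Fp cT1 cS1.
have := corner_turn X0 sT T0 sp Fp cT2 cS2.
rewrite -[k + 1 + 3]addrA Z4E addr0 => s2.
have [h [g [_ _ sq F _]]] := frame_param (edet_neq0 X0 k).
have /sq[ha hb] := sp; have P0 : patch X k (h p).1 (h p).2 = 0 by rewrite -F.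
have dE := det2_edge X0 P0.
move: (sp); rewrite /square /= !in_itv /= => -[sp1 sp2].
have J0 := mulr_gt0 (derive1_reg_inv_gt0 rpsi sp1) (derive1_reg_inv_gt0 rphi sp2).
rewrite /node_focus_center_type /saddle_type det_Jac.
(* Both corners have the sign of the Jacobian at p, hence so does the convex combination in
   [det2_edge]. *)
have pos : 0 < \det (DFtilde X p) * det2 (X k) (X (k + 1)).
  rewrite dE mulrCA mulr_gt0//; first by lra.
  rewrite mulrDr mulrCA [X in _ + X]mulrCA addr_gt0// mulr_gt0//; lra.
split=> h0.
  by move: pos; rewrite (pmulr_lgt0 _ h0) (pmulr_lgt0 _ J0).
by move: pos; rewrite (nmulr_lgt0 _ h0) (pmulr_llt0 _ J0).
Qed.
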